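(* Let $\alpha\ge 1/2$ and let $\phi(n)=e^{n^{\alpha}}$ for $n\in\mathbb N$. Then $\dim_{\mathcal H}E(\phi)=\frac12$.
   Context: Every irrational $x\in(0,1)$ has a unique simple continued fraction expansion $x=[a_1(x),a_2(x),a_3(x),\ldots]=\cfrac{1}{a_1(x)+\cfrac{1}{a_2(x)+\cdots}}$ with positive integers $a_n(x)$ (partial quotients). For irrational $x\in(0,1)$ and $n\ge1$, $S_n(x)=\sum_{i=1}^n a_i(x)a_{i+1}(x)$. For a function $\phi:\mathbb N\to\mathbb R_+$, $E(\phi)$ is the set of (irrational) $x\in(0,1)$ such that $\lim_{n\to\infty}S_n(x)/\phi(n)=1$. $\dim_{\mathcal H}$ denotes Hausdorff dimension. *)

(* Defs.v *)
From HB Require Import structures.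
From mathcomp Require Import all_boot all_order all_algebra.
From mathcomp Require Import all_classical all_reals all_analysis.

Set Implicit Arguments.
Unset Strict Implicit.
Unset Printing Implicit Defensive.

Import Order.TTheory GRing.Theory Num.Theory.
Import numFieldNormedType.Exports.

Local Open Scope classical_set_scope.
Local Open Scope ring_scope.

(* [0 |` ...] makes the diameter of the empty set 0. *)
Definition diam (R : realType) (U : set R) : \bar R :=
  ereal_sup (0%E |` [set `|z.1 - z.2|%:E | z in U `*` U]).

(* The empty set has gauge 0 even when [s = 0], where [0 `^ 0 = 1]; hence the
   0-dimensional Hausdorff measure is the counting measure. *)
Definition hausdorff_gauge (R : realType) (s : R) (U : set R) : \bar R :=
  if U == set0 then 0%E else (diam U `^ s)%E.

Definition hausdorff_premeasure (R : realType) (s delta : R) (E : set R) :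
    \bar R :=
  ereal_inf [set (\sum_(0 <= i <oo) hausdorff_gauge s (U i))%E |
    U in [set U : nat -> set R |
      E `<=` \bigcup_i U i /\ forall i, (diam (U i) <= delta%:E)%E]].

(* The premeasure is nonincreasing in [delta], so the supremum is the limit as
   [delta] tends to 0. *)
Definition hausdorff_measure (R : realType) (s : R) (E : set R) : \bar R :=
  ereal_sup [set hausdorff_premeasure s delta E | delta in [set d : R | 0 < d]].

Definition hausdorff_dim (R : realType) (E : set R) : \bar R :=
  ereal_inf [set s%:E | s in [set s : R | 0 <= s /\ hausdorff_measure s E = 0%E]].

(* [cfrac [:: k1; ...; kn]] is 1 / (k1 + 1 / (k2 + ... + 1 / kn)). *)
Definition cfrac (R : realType) (ks : seq nat) : R :=
  foldr (fun k r => (k%:R + r)^-1) 0 ks.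

(* x = [a 1, a 2, ...]; sequences are indexed from 1 and [a 0] is irrelevant. *)
Definition cf_expansion (R : realType) (x : R) (a : nat -> nat) : Prop :=
  (forall n, (0 < n)%N -> (0 < a n)%N) /\
  cfrac R [seq a i | i <- iota 1 n] @[n --> \oo] --> x.

Definition cf_sum (a : nat -> nat) (n : nat) : nat :=
  (\sum_(1 <= i < n.+1) a i * a i.+1)%N.

(* An irrational [x] in (0, 1) has exactly one expansion (up to [a 0]), so
   [exists a] just names its sequence of partial quotients. *)
Definition E_set (R : realType) (phi : nat -> R) : set R :=
  [set x : R | [/\ 0 < x < 1, irrational x &
    exists a : nat -> nat, cf_expansion x a /\
      (cf_sum a n)%:R / phi n @[n --> \oo] --> (1 : R)]].

(* Main.v *)
Require Import Defs.
From mathcomp Require Import all_boot all_order all_algebra.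
From mathcomp Require Import all_classical all_reals all_analysis.
From mathcomp Require Import ring lra.
Import Order.TTheory GRing.Theory Num.Theory.
Import numFieldNormedType.Exports.
Local Open Scope classical_set_scope.
Local Open Scope ring_scope.

(* Write phi(n) = e^(n^alpha).

   Upper bound.  As alpha >= 1/2, phi grows by a definite factor over windows
   of length about delta * sqrt n, so every such window contributes at least
   c * phi(n) to the sum, and hence the product of the terms a_i a_{i+1} over
   the window is at least c * 2^(-length) * e^(sqrt n).  Multiplying over the
   windows inside (N, 2N] and letting delta tend to 0 shows that a_1 ... a_n
   exceeds e^(Mn) infinitely often, for every M.  The intervals of radius
   (a_1 ... a_n)^(-2) around the convergents with such large products form
   covers whose s-dimensional sums tend to 0 when s > 1/2, because the sum of
   k^(-t) converges for 1 < t < 2s.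

   Lower bound.  Let w_1 = 1 and w_n w_{n+1} = phi(n) - phi(n-1); then w_n
   tends to infinity.  If a_n ranges over a block of about w_n / n integers
   starting at about w_n, then a_n a_{n+1} ~ phi(n) - phi(n-1), so S_n ~ phi(n).
   Reading the position in each block as a mixed-radix digit of u in [0, 1)
   defines a map G from [0, 1) to E(phi) with |u - v| <= C |G u - G v|^s for
   each s < 1/2, because a block has about w_n^(1 - o(1)) elements while
   cylinders have length about the product of the w_i^(-2).  A cover of E(phi)
   then pulls back to a cover of [0, 1), which has positive Lebesgue measure. *)

(** * Continued fractions *)

(** The inverse branch of the Gauss map along [w]; [cfrac R w] is its value at 0. *)
Definition cf_map {R : realType} (w : seq nat) (x : R) : R :=
  foldr (fun k r => (k%:R + r)^-1) x w.

Lemma cfrac_cat {R : realType} (w v : seq nat) :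
  cfrac R (w ++ v) = cf_map w (cfrac R v).
Proof. by rewrite /cfrac foldr_cat. Qed.

Lemma cf_map_itv {R : realType} (w : seq nat) (x : R) :
  all (leq 1) w -> 0 <= x <= 1 -> 0 <= cf_map w x <= 1.
Proof.
elim: w => [//|k w IH] /= /andP[k0 w0] xI.
have /andP[c0 c1] := IH w0 xI.
have k1 : (1 : R) <= k%:R by rewrite ler1n.
have kc : 1 <= k%:R + cf_map w x by lra.
by rewrite invr_ge0 invf_le1 ?kc ?andbT//; lra.
Qed.

Lemma cfrac_itv {R : realType} (w : seq nat) :
  all (leq 1) w -> 0 <= cfrac R w <= 1.
Proof. by move=> w0; apply: cf_map_itv => //; rewrite lexx ler01. Qed.

Lemma dist_inv {R : realType} (u v : R) : 0 < u -> 0 < v ->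
  `|u^-1 - v^-1| = `|u - v| / (u * v).
Proof.
move=> u0 v0.
rewrite (_ : u^-1 - v^-1 = (v - u) / (u * v)); last by field; lra.
by rewrite normrM distrC normfV [`|u * v|]gtr0_norm// mulr_gt0.
Qed.

(** Each map x -> 1 / (k + x) shrinks distances in [0, 1] by k^(-2), because both denominators are
    at least k. *)
Lemma cf_map_contract {R : realType} (w : seq nat) (x y : R) :
  all (leq 1) w -> 0 <= x <= 1 -> 0 <= y <= 1 ->
  `|cf_map w x - cf_map w y| <= `|x - y| * \prod_(k <- w) (k%:R ^- 2).
Proof.
move=> + xI yI; elim: w => [_|k w IH /= /andP[k0 w0]].
  by rewrite big_nil mulr1.
have /andP[x0 x1] := cf_map_itv w x w0 xI.
have /andP[y0 y1] := cf_map_itv w y w0 yI.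
have k1 : (1 : R) <= k%:R by rewrite ler1n.
rewrite big_cons dist_inv; [|lra|lra].
rewrite (_ : k%:R + _ - _ = cf_map w x - cf_map w y); last by ring.
rewrite mulrCA mulrC; apply: ler_pM => //.
- by rewrite invr_ge0 mulr_ge0//; lra.
- rewrite lef_pV2 ?posrE//; [|nra|nra].
  by rewrite expr2; nra.
- exact: IH.
Qed.

Notation prefix_of a n := [seq a i | i <- iota 1 n] (only parsing).

Lemma prefix_gt0 (a : nat -> nat) n :
  (forall i, (0 < i)%N -> (0 < a i)%N) -> all (leq 1) (prefix_of a n).
Proof.
move=> a0; apply/allP => _ /mapP[i + ->].
by rewrite mem_iota => /andP[i1 _]; exact: a0.
Qed.

(** The n-th convergent and all later ones are values of the same contraction
    [cf_map (prefix_of a n)] at points of [0, 1]; the bound passes to the limit. *)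
Lemma cf_expansion_near {R : realType} (x : R) (a : nat -> nat) n :
  cf_expansion x a ->
  `|x - cfrac R (prefix_of a n)| <= \prod_(k <- prefix_of a n) (k%:R ^- 2).
Proof.
move=> [a0 ax].
set l := \prod_(k <- _) _; set c := cfrac R _.
have cc : `|cfrac R [seq a i | i <- iota 1 m] - c| @[m --> \oo] --> `|x - c|.
  by apply: cvg_norm; apply: cvgB => //; exact: cvg_cst.
rewrite -(cvg_lim _ cc)//; apply: limr_le; first by apply/cvg_ex; eexists; exact: cc.
near=> m.
have nm : (n <= m)%N by near: m; exact: nbhs_infty_ge.
rewrite -(subnKC nm) iotaD map_cat cfrac_cat /c.
have xI : 0 <= cfrac R [seq a i | i <- iota (1 + n) (m - n)] <= 1.
  apply: cfrac_itv; apply/allP => _ /mapP[i + ->].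
  by rewrite mem_iota => /andP[i1 _]; apply: a0; exact: leq_trans i1.
have I0 : 0 <= (0 : R) <= 1 by rewrite lexx ler01.
apply: le_trans (cf_map_contract _ _ _ (prefix_gt0 a n a0) xI I0) _.
rewrite -/l -[leRHS]mul1r ler_wpM2r//.
  by apply: prodr_ge0 => i _; rewrite invr_ge0 exprn_ge0.
by rewrite subr0 ger0_norm; case/andP: xI.
Unshelve. all: by end_near. Qed.

(** * Sums over words of partial quotients *)

(** The ratio of k^(-e) to (k + 1)^(-e) is exp(e (ln(k + 1) - ln k)), which is at least 1 + e / (k +
    1). This telescoping bound replaces the integral test. *)
Lemma powRN_telescope {R : realType} (e k : R) : 0 < e -> 0 < k ->
  e * (k + 1) `^ (- (1 + e)) <= k `^ (- e) - (k + 1) `^ (- e).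
Proof.
move=> e0 k0; have k1 : 0 < k + 1 by lra.
have lnk : (k + 1)^-1 <= ln (k + 1) - ln k.
  have /le_ln1Dx : -1 < - (k + 1)^-1 :> R.
    by rewrite ltrN2 invf_lt1//; lra.
  rewrite (_ : 1 - _ = k / (k + 1)); last by field; lra.
  by rewrite ln_div ?posrE//; lra.
have -> : k `^ (- e) = (k + 1) `^ (- e) * expR (e * (ln (k + 1) - ln k)).
  by rewrite /powR !gt_eqF// -expRD; congr expR; ring.
rewrite opprD powRD; last by apply/implyP => _; rewrite gt_eqF.
rewrite powR_inv1; last by lra.
set y := (_ `^ (- e)); have y0 : 0 < y by rewrite powR_gt0.
have := expR_ge1Dx (e * (ln (k + 1) - ln k)).
set z := expR _ => zge.
have : e * (k + 1)^-1 <= z - 1.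
  by apply: (@le_trans _ _ (e * (ln (k + 1) - ln k))); [rewrite ler_pM2l|lra].
nra.
Qed.

Lemma zeta_partial_sum {R : realType} (e : R) K : 0 < e ->
  \sum_(0 <= k < K) (k%:R : R) `^ (- (1 + e)) <= 1 + e^-1.
Proof.
move=> e0; have e1 : 0 < e^-1 by rewrite invr_gt0.
case: K => [|[|K]].
- by rewrite big_geq//; lra.
- by rewrite big_nat1 powR0; [lra|apply/eqP; lra].
(* The term k = 0 vanishes: 0 to a nonzero power is 0 by convention. *)
rewrite big_nat_recl// powR0 ?add0r; last by apply/eqP; lra.
suff : \sum_(0 <= k < K.+1) (k.+1%:R : R) `^ (- (1 + e))
       <= 1 + e^-1 * (1 - (K.+1%:R : R) `^ (- e)).
  move=> /le_trans; apply; rewrite lerD2l ler_piMr//; first exact: ltW.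
elim: K => [|K IH]; first by rewrite big_nat1 !powR1/=; lra.
rewrite big_nat_recr//=; apply: (le_trans (lerD IH (lexx _))).
have k0 : 0 < K.+1%:R :> R by rewrite ltr0n.
have := powRN_telescope e _ e0 k0.
rewrite natr1 -(ler_pM2l e1) mulKf ?gt_eqF// => h.
by lra.
Qed.

Fixpoint words (K n : nat) : seq (seq nat) :=
  if n is n'.+1 then [seq k :: w | k <- iota 0 K, w <- words K n'] else [:: [::]].

Lemma mem_words K (w : seq nat) :
  all (fun k => k < K)%N w -> w \in words K (size w).
Proof.
elim: w => [|k w IH]//= /andP[kK wK].
by apply/allpairsP; exists (k, w) => /=; rewrite mem_iota/= add0n kK IH.
Qed.

Lemma sum_words {R : realType} (g : nat -> R) K n :
  \sum_(w <- words K n) \prod_(k <- w) g k = (\sum_(0 <= k < K) g k) ^+ n.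
Proof.
elim: n => [|n IH]; first by rewrite big_seq1 big_nil expr0.
rewrite /= big_allpairs_dep exprS -IH big_distrlr/= /index_iota subn0.
by apply: eq_bigr => k _; apply: eq_bigr => w _; rewrite big_cons.
Qed.

Lemma ler_sum_uniq {R : realType} {T : eqType} (F : T -> R) (s l : seq T) :
  (forall x, 0 <= F x) -> uniq s -> {subset s <= l} ->
  \sum_(x <- s) F x <= \sum_(x <- l) F x.
Proof.
move=> F0; elim: s l => [|x s IH] l /=.
  by rewrite big_nil => _ _; apply: sumr_ge0.
move=> /andP[xs us] sl.
have xl : x \in l by apply: sl; rewrite mem_head.
rewrite big_cons (big_rem x xl)/= lerD2l; apply: IH => // y ys.
have /sl : y \in x :: s by rewrite inE ys orbT.
rewrite (perm_mem (perm_to_rem xl)) inE => /orP[/eqP yx|//].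
by rewrite yx (negbTE xs) in ys.
Qed.

(** The words of length n over a finite alphabet contribute the n-th power of the sum of [g], at
    most 2^(-n), and a geometric series remains. *)
Lemma sum_long_words {R : realType} (g : nat -> R) n0 (ws : seq (seq nat)) :
  (forall k, 0 <= g k) -> (forall K, \sum_(0 <= k < K) g k <= 2^-1) ->
  uniq ws -> all (fun w => n0 <= size w)%N ws ->
  \sum_(w <- ws) \prod_(k <- w) g k <= 2 * 2^-1 ^+ n0.
Proof.
move=> g0 gK uws wsn.
(* One number bounds both the lengths and the letters occurring in [ws]. *)
pose K := (n0 + \max_(w <- ws) maxn (size w) (\max_(k <- w) k)).+1.
have wK w : w \in ws -> (size w < K)%N /\ all (fun k => k < K)%N w.
  move=> wws.
  have le1 : (maxn (size w) (\max_(k <- w) k) < K)%N.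
    rewrite ltnS; apply: leq_trans (leq_addl _ _).
    by rewrite (big_rem w wws)/= leq_maxl.
  split; first by apply: leq_ltn_trans le1; rewrite leq_maxl.
  apply/allP => k kw; apply: leq_ltn_trans le1.
  by apply: leq_trans (leq_maxr _ _); rewrite (big_rem k kw)/= leq_maxl.
apply: (@le_trans _ _ (\sum_(w <- flatten [seq words K n | n <- index_iota n0 K])
    \prod_(k <- w) g k)).
  apply: ler_sum_uniq => //; first by move=> w; apply: prodr_ge0.
  move=> w wws; have [sK aK] := wK w wws.
  apply/flattenP; exists (words K (size w)); last exact: mem_words.
  by apply: map_f; rewrite mem_index_iota sK andbT; move/allP: wsn; apply.
rewrite big_flatten/= big_map.
apply: (@le_trans _ _ (\sum_(n0 <= n < K) 2^-1 ^+ n)).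
  by apply: ler_sum => n _; rewrite sum_words lerXn2r ?nnegrE// sumr_ge0.
suff : forall m, \sum_(n0 <= n < n0 + m) 2^-1 ^+ n
    = 2 * 2^-1 ^+ n0 * (1 - 2^-1 ^+ m) :> R.
  rewrite -(@subnKC n0 K); last by rewrite /K; apply: leqW; exact: leq_addr.
  by move=> ->; rewrite ler_piMr// lerBlDl ler_wpDl.
elim=> [|m IH]; first by rewrite addn0 big_geq// expr0 subrr mulr0.
rewrite addnS big_nat_recr ?leq_addr//= IH exprD exprS.
by field.
Qed.

(** * Hausdorff measure: covers *)

Lemma diam_ge0 {R : realType} (U : set R) : (0 <= diam U)%E.
Proof. by apply: ereal_sup_ubound; left. Qed.

Lemma diam_ball_le {R : realType} (c r : R) : 0 <= r ->
  (diam (closed_ball_ Num.norm c r) <= (2 * r)%:E)%E.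
Proof.
move=> r0; apply: ge_ereal_sup => _ [->|[[x y] [/= hx hy] <-]].
  by rewrite lee_fin mulr_ge0.
rewrite lee_fin (_ : x - y = (c - y) - (c - x)); last by ring.
by rewrite (le_trans (ler_normB _ _))// mulr_natl mulr2n lerD.
Qed.

Lemma hausdorff_gauge_ge0 {R : realType} (s : R) (U : set R) :
  (0 <= hausdorff_gauge s U)%E.
Proof. by rewrite /hausdorff_gauge; case: ifP => // _; exact: poweR_ge0. Qed.

Lemma hausdorff_gauge_ball_le {R : realType} (s c r : R) : 0 <= s -> 0 <= r ->
  (hausdorff_gauge s (closed_ball_ Num.norm c r) <= ((2 * r) `^ s)%:E)%E.
Proof.
move=> s0 r0; rewrite /hausdorff_gauge; case: ifP => _.
  by rewrite lee_fin powR_ge0.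
rewrite -poweR_EFin; apply: gt0_ler_poweR => //; rewrite ?in_itv/= ?leey ?andbT.
- exact: diam_ge0.
- by rewrite lee_fin mulr_ge0.
- exact: diam_ball_le.
Qed.

Lemma hausdorff_premeasure_le {R : realType} (s d : R) (E : set R)
    (U : nat -> set R) (B : R) :
  E `<=` \bigcup_i U i -> (forall i, (diam (U i) <= d%:E)%E) ->
  (forall n, (\sum_(0 <= i < n) hausdorff_gauge s (U i) <= B%:E)%E) ->
  (hausdorff_premeasure s d E <= B%:E)%E.
Proof.
move=> EU Ud UB; apply: (@le_trans _ _ (\sum_(0 <= i <oo) hausdorff_gauge s (U i))%E).
  by apply: ereal_inf_lbound; exists U.
apply: lime_le; last by apply: nearW => n; exact: UB.
by apply: is_cvg_nneseries => n _ _; exact: hausdorff_gauge_ge0.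
Qed.

Lemma hausdorff_measure_eq0 {R : realType} (s : R) (E : set R) :
  (forall d e, 0 < d -> 0 < e -> (hausdorff_premeasure s d E <= e%:E)%E) ->
  hausdorff_measure s E = 0%E.
Proof.
move=> h; apply/eqP; rewrite eq_le; apply/andP; split.
  apply: ge_ereal_sup => _ [d /= d0 <-]; apply/lee_addgt0Pr => e e0.
  by rewrite add0e h.
apply: ereal_sup_ge; exists (hausdorff_premeasure s 1 E); first by exists 1 => /=.
apply: le_ereal_inf_tmp => _ [U _ <-].
by apply: nneseries_ge0 => n _ _; exact: hausdorff_gauge_ge0.
Qed.

Lemma powR_prod {R : realType} (w : seq nat) (p : R) :
  (\prod_(k <- w) (k%:R : R)) `^ p = \prod_(k <- w) (k%:R `^ p).
Proof.
elim: w => [|k w IH]; first by rewrite !big_nil powR1.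
by rewrite !big_cons powRM ?IH// prodr_ge0.
Qed.

Lemma exists_small_geo {R : realType} (e : R) : 0 < e ->
  exists n : nat, 2^-1 ^+ n <= e.
Proof.
move=> e0; exists (Num.trunc e^-1).+1.
have : e^-1 < (Num.trunc e^-1).+1%:R.
  by apply: truncnS_gt.
move: (_.+1) => n en.
have n0 : 0 < n%:R :> R by apply: le_lt_trans en; rewrite invr_ge0 ltW.
rewrite exprVn -[leRHS]invrK lef_pV2 ?posrE ?invr_gt0 ?exprn_gt0//.
by apply: (le_trans (ltW en)); rewrite -natrX ler_nat ltnW// ltn_expl.
Qed.

(** Balls of radius P(w)^(-2) about [cfrac R w], over long words w whose product P(w) is at least
    e^(M |w|), cover [E]. The largeness of P(w) supplies a small factor for each letter, so the sum
    over all such words is the tail of a geometric series. *)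
Lemma hausdorff_measure_large_prod {R : realType} (s : R) (E : set R) :
  2^-1 < s ->
  (forall x, E x -> exists a, cf_expansion x a /\ forall M n0 : nat,
    exists2 n, (n0 <= n)%N &
      expR (M%:R * n%:R) <= \prod_(k <- prefix_of a n) (k%:R : R)) ->
  hausdorff_measure s E = 0%E.
Proof.
move=> s2 hE; apply: hausdorff_measure_eq0 => d eps d0 eps0.
pose e := s - 2^-1; have e0 : 0 < e by rewrite subr_gt0.
have s0 : 0 <= s by lra.
pose Z := 1 + e^-1; have Z0 : 0 < Z by rewrite addr_gt0// invr_gt0.
(* [Z] bounds the sum of k^(-(1 + e)); [M] is large enough that the factor [q] per letter brings it
   down to 1/2. *)
pose M := (Num.trunc (ln (2 * Z) / e)).+1.
pose q := expR (- (M%:R * e)).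
have qZ : q * Z <= 2^-1.
  have : ln (2 * Z) / e < M%:R by apply: truncnS_gt.
  rewrite ltr_pdivrMr// -ltr_expR lnK ?posrE ?mulr_gt0// => h.
  rewrite /q expRN mulrC ler_pdivrMr ?expR_gt0// mulrC.
  by rewrite ler_pdivlMr// mulrC ltW.
have B0 : 0 < eps / (2 `^ s * 2) by rewrite divr_gt0// mulr_gt0// powR_gt0.
have [n0 n0P] := exists_small_geo (Num.min (eps / (2 `^ s * 2)) (d / 2))
  ltac:(by rewrite lt_min B0 divr_gt0).
have {n0P} [n0e n0d] : 2^-1 ^+ n0 <= eps / (2 `^ s * 2) /\ 2^-1 ^+ n0 <= d / 2.
  by move: n0P; rewrite le_min => /andP.
pose P w := \prod_(k <- w) (k%:R : R).
pose good w := [&& (n0 <= size w)%N, all (leq 1) w &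
  expR (M%:R * (size w)%:R) <= P w].
pose r w := \prod_(k <- w) (k%:R ^- 2 : R).
pose V w := if good w then closed_ball_ Num.norm (cfrac R w) (r w) else set0.
(* Words are enumerated by their codes; indices that code no good word get the empty set, whose
   gauge is 0. *)
pose U i := if (pickle_inv i : option (seq nat)) is Some w then V w else set0.
pose g k := (k%:R : R) `^ (- (1 + e)) * q.
have r0 w : 0 <= r w by apply: prodr_ge0 => k _; rewrite invr_ge0 exprn_ge0.
have rP w : r w = P w ^- 2 by rewrite /r prodfV prodrXl.
have P0 w : good w -> 0 < P w.
  by case/and3P => _ _; apply: lt_le_trans; exact: expR_gt0.
have rV w : good w -> (2 * r w) `^ s <= 2 `^ s * \prod_(k <- w) g k.
  move=> gw; have Pw := P0 w gw.
  rewrite powRM// ler_pM2l ?powR_gt0// rP -powR_invn; last exact: ltW.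
  (* The exponent -(1 + e) keeps the sum over letters convergent; the remaining -e turns the
     largeness of P(w) into one factor [q] per letter. *)
  rewrite -powRrM (_ : - 2%:R * s = - (1 + e) + - e); last by rewrite /e; lra.
  rewrite powRD; last by apply/implyP => _; rewrite gt_eqF.
  rewrite /P powR_prod -/(P w) /g big_split/= ler_wpM2l//.
    by apply: prodr_ge0 => k _; rewrite powR_ge0.
  rewrite big_const_seq count_predT iter_mulr mulr1 /q -expRM_natr.
  rewrite powRN mulNr expRN lef_pV2 ?posrE ?powR_gt0 ?expR_gt0//.
  rewrite mulrAC expRM; case/and3P: gw => _ _ gw.
  by apply: ge0_ler_powR => //; rewrite ?nnegrE ?expR_ge0 //; exact: ltW.
have rd w : good w -> 2 * r w <= d.
  move=> gw; have Pw := P0 w gw.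
  rewrite mulrC -ler_pdivlMr//; apply: le_trans n0d.
  have P2 : 2 ^+ n0 <= P w.
    case/and3P: gw => sw _; apply: le_trans.
    apply: (@le_trans _ _ (2 ^+ size w)); first by rewrite ler_eXn2l ?ltr1n.
    rewrite mulrC expRM_natl lerXn2r ?nnegrE ?expR_ge0//.
    apply: le_trans (expR_ge1Dx _); rewrite -[leLHS]natr1 addrC lerD2l.
    by rewrite ler1n.
  have P1 : 1 <= P w by apply: le_trans P2; rewrite exprn_ege1// ler1n.
  rewrite rP exprVn lef_pV2 ?posrE ?exprn_gt0//.
  by apply: le_trans P2 _; rewrite expr2 ler_peMl// ltW.
apply: (hausdorff_premeasure_le s d E U).
- move=> x /hE[a [ax /(_ M n0)[n n0n large]]].
  have gw : good [seq a i | i <- iota 1 n].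
    by rewrite /good size_map size_iota n0n large prefix_gt0//; case: ax.
  exists (pickle [seq a i | i <- iota 1 n]) => //.
  rewrite /U pickleK_inv /V gw /closed_ball_/= distrC.
  exact: cf_expansion_near.
- have d00 : (diam (set0 : set R) <= d%:E)%E.
    apply: ge_ereal_sup => _ [->|[z [[]]//]]; first by rewrite lee_fin ltW.
  move=> i; rewrite /U; case: pickle_inv => [w|//]; rewrite /V.
  case: ifPn => // gw; apply: le_trans (diam_ball_le _ _ (r0 w)) _.
  by rewrite lee_fin rd.
move=> n.
pose ws l := [seq w <- pmap (@pickle_inv (seq nat)) l | good w].
have sumws l : (\sum_(i <- l) hausdorff_gauge s (U i)
    <= (\sum_(w <- ws l) 2 `^ s * \prod_(k <- w) g k)%:E)%E.
  elim: l => [|i l IH]; first by rewrite !big_nil.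
  rewrite big_cons /ws/= /U; case: pickle_inv => [w|]/=; last first.
    by rewrite /hausdorff_gauge eqxx add0e.
  rewrite /V; case: ifPn => gw; last by rewrite /hausdorff_gauge eqxx add0e.
  rewrite big_cons EFinD; apply: leeD IH.
  by apply: le_trans (hausdorff_gauge_ball_le _ _ _ s0 (r0 w)) _; rewrite lee_fin rV.
apply: le_trans (sumws _) _; rewrite lee_fin -mulr_sumr.
have g0 k : 0 <= g k by rewrite mulr_ge0 ?powR_ge0 ?expR_ge0.
have gK K : \sum_(0 <= k < K) g k <= 2^-1.
  rewrite -mulr_suml; apply: le_trans qZ; rewrite mulrC ler_wpM2l ?expR_ge0//.
  exact: zeta_partial_sum.
have := sum_long_words g n0 (ws (index_iota 0 n)) g0 gK.
rewrite filter_uniq; last by apply: (pmap_uniq (@pickle_invK _)); exact: iota_uniq.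
have -> : all (fun w => n0 <= size w)%N (ws (index_iota 0 n)).
  by apply/allP => w; rewrite mem_filter => /andP[/and3P[]].
move=> /(_ isT isT) h.
have p0 : 0 < 2 `^ s :> R by rewrite powR_gt0.
apply: le_trans (ler_wpM2l (ltW p0) h) _.
by rewrite mulrA mulrC -ler_pdivlMr// mulr_gt0.
Qed.

(** * Products of partial quotients of elements of E(phi) *)

(** In t^q - s^q = s^q ((t / s)^q - 1) both factors are nondecreasing in q, so the case q = 1/2 is
    the smallest. This is how p >= 1/2 enters. *)
Lemma powR_increment {R : realType} (p s t : R) : 2^-1 <= p -> 1 <= s -> s <= t ->
  Num.sqrt t - Num.sqrt s <= t `^ p - s `^ p.
Proof.
move=> hp s1 st; have s0 : 0 < s by lra.
have t0 : 0 < t by lra.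
have c1 : 1 <= t / s by rewrite ler_pdivlMr// mul1r.
have tE (q : R) : t `^ q = s `^ q * (t / s) `^ q.
  by rewrite -powRM ?ltW ?divr_gt0// mulrCA divff ?mulr1// gt_eqF.
rewrite -!powR12_sqrt; [|exact: ltW|exact: ltW].
rewrite !tE -[X in _ * _ - X]mulr1 -[X in _ <= _ - X]mulr1 -!mulrBr.
apply: ler_pM; rewrite ?powR_ge0//.
- have /(_ 0 2^-1) := ler_powR c1; rewrite powRr0 subr_ge0; apply.
  by rewrite invr_ge0.
- exact: ler_powR.
- by rewrite lerD2r; exact: ler_powR.
Qed.

Lemma sqrt_le {R : realType} (z y : R) : 0 <= y -> z <= y ^+ 2 -> Num.sqrt z <= y.
Proof. by move=> y0 zy; rewrite -[leRHS]ger0_norm// -sqrtr_sqr ler_wsqrtr. Qed.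

Lemma sqrt_increment {R : realType} (x q c : R) : 0 <= x -> 0 <= q -> 0 < c ->
  Num.sqrt (x + q) + Num.sqrt x <= c ->
  q / c <= Num.sqrt (x + q) - Num.sqrt x.
Proof.
move=> x0 q0 c0 sc; rewrite ler_pdivrMr//.
rewrite [leLHS](_ : q = (Num.sqrt (x + q) - Num.sqrt x) * (Num.sqrt (x + q) + Num.sqrt x)); last first.
  by rewrite -subr_sqr !sqr_sqrtr ?addr_ge0// addrC addKr.
rewrite ler_wpM2l//.
by rewrite subr_ge0 ler_wsqrtr// lerDl.
Qed.

(** Induction on 1 + S + b <= 2 b (1 + S) for b >= 1: a large sum forces a large product, at the
    price of a factor 2 per term. *)
Lemma sum_lt_prod {R : realType} (b : nat -> R) (m n : nat) :
  (forall i, (m <= i)%N -> 1 <= b i) -> (m <= n)%N ->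
  1 + \sum_(m <= i < n) b i <= \prod_(m <= i < n) (2 * b i).
Proof.
move=> b1 mn; rewrite -(subnKC mn); elim: (n - m)%N => [|k IH].
  by rewrite addn0 !big_geq// addr0.
have mk : (m <= m + k)%N by exact: leq_addr.
have bk := b1 _ mk.
have S0 : 0 <= \sum_(m <= i < m + k) b i.
  rewrite big_nat_cond; apply: sumr_ge0 => i /andP[/andP[mi _] _].
  exact: le_trans ler01 (b1 _ mi).
by rewrite addnS !big_nat_recr//=; nra.
Qed.

Lemma prod_nat_widen (a : nat -> nat) (k m n l : nat) :
  (forall i, (0 < i)%N -> (0 < a i)%N) -> (0 < k)%N ->
  (k <= m)%N -> (m <= n)%N -> (n <= l)%N ->
  (\prod_(m <= i < n) a i <= \prod_(k <= i < l) a i)%N.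
Proof.
move=> a0 k0 km mn nl.
rewrite (@big_cat_nat _ _ _ m k l)//=; last exact: leq_trans nl.
rewrite (@big_cat_nat _ _ _ n m l)//=.
have pos u v : (k <= u)%N -> (0 < \prod_(u <= i < v) a i)%N.
  move=> ku; rewrite big_nat_cond; apply: prodn_cond_gt0 => i.
  by move=> /andP[/andP[ui _] _]; apply: a0; apply: leq_trans ui; exact: leq_trans ku.
rewrite mulnCA leq_pmulr// muln_gt0 !pos//.
by apply: leq_trans mn.
Qed.

(** For x between (l q)^2 and twice that, a window of length q raises sqrt x by at least 1 / (3 l),
    hence e^(x^p) by a factor at least 1 + 4 e with e = 1 / (12 l). This outweighs a relative error
    e at both ends. *)
Lemma exp_powR_window {R : realType} (p l q x : R) : 2^-1 <= p ->
  12 <= l -> 24 <= q -> (l * q) ^+ 2 <= x -> x + q <= 2 * (l * q) ^+ 2 ->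
  expR (l * q / 2) <= (1 - (12 * l)^-1) * expR ((x + q) `^ p)
    - (1 + (12 * l)^-1) * expR (x `^ p).
Proof.
move=> hp l12 q24 xN xqN.
have lq : 12 <= l * q by nra.
have x1 : 1 <= x by nra.
have xq : x <= x + q by lra.
have sx : expR (l * q) <= expR (x `^ p).
  rewrite ler_expR; apply: (@le_trans _ _ (Num.sqrt x)).
    by rewrite -[leLHS]ger0_norm -?sqrtr_sqr ?ler_wsqrtr//; lra.
  by rewrite -powR12_sqrt; [exact: ler_powR|lra].
have incr : (3 * l)^-1 <= (x + q) `^ p - x `^ p.
  apply: le_trans (powR_increment p x (x + q) hp x1 xq).
  rewrite (_ : (3 * l)^-1 = q / (3 * (l * q))); last by field; lra.
  apply: sqrt_increment; [lra|lra|lra|].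
  suff h z : z <= 2 * (l * q) ^+ 2 -> Num.sqrt z <= 3 / 2 * (l * q).
    by have := h _ xqN; have := h x (le_trans xq xqN); lra.
  by move=> zle; apply: sqrt_le; nra.
set e := (12 * l)^-1.
have le12 : l * e = 12^-1 by rewrite /e; field; lra.
have e0 : 0 < e by rewrite invr_gt0; lra.
have e4 : (3 * l)^-1 = 4 * e by rewrite /e; field; lra.
have {}incr : (1 + 4 * e) * expR (x `^ p) <= expR ((x + q) `^ p).
  have -> : (x + q) `^ p = ((x + q) `^ p - x `^ p) + x `^ p by rewrite subrK.
  rewrite expRD ler_pM2r ?expR_gt0//.
  by apply: le_trans (expR_ge1Dx _); rewrite lerD2l -e4.
(* Since l e = 1/12 and q >= 24, e (1 + l q / 2) exceeds q / 24 >= 1. *)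
have half : expR (l * q / 2) <= e * expR (l * q).
  rewrite (_ : l * q = l * q / 2 + l * q / 2); last by field.
  rewrite expRD (_ : (l * q / 2 + l * q / 2) / 2 = l * q / 2); last by field.
  have := expR_ge1Dx (l * q / 2); move: (expR _) (expR_ge0 (l * q / 2)) => X X0 X1.
  rewrite mulrA ler_peMl//.
  apply: (@le_trans _ _ (e * (1 + l * q / 2))); last by rewrite ler_pM2l.
  rewrite (_ : _ * _ = e + (l * e) * q / 2); last by ring.
  by rewrite le12; lra.
have e12 : e <= 12^-1.
  by rewrite -le12 ler_peMl; lra.
apply: (le_trans half); move: incr sx {half xN xqN lq x1 xq e4 le12}.
move: (expR _) (expR (x `^ p)) (expR (l * q)) (expR_gt0 (l * q)) => U V Z Z0 UV ZV.
apply: (@le_trans _ _ (e * V)); first by rewrite ler_pM2l.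
(* (1 - e)(1 + 4 e) - (1 + e) = 2 e - 4 e^2 is at least e, as e <= 1/12. *)
apply: (@le_trans _ _ ((1 - e) * ((1 + 4 * e) * V) - (1 + e) * V)).
  have : 0 <= (e * (1 - 4 * e)) * V.
    by apply: mulr_ge0; [apply: mulr_ge0; lra|lra].
  by lra.
by rewrite lerD2r ler_pM2l//; lra.
Qed.

(** With N = (L P)^2 the range (N, 2N] splits into L^2 P windows of length P, each contributing e^(L
    P / 2), in total e^(L N / 2). The factors 2 cost at most e^N, and passing from the a_i a_{i+1}
    to the a_i costs a square. With L = 12 M + 12 the exponent (6 M + 5) N left for the square
    exceeds 2 M (2 N + 1). *)
Lemma E_set_large_prod {R : realType} (p : R) (a : nat -> nat) (M n0 : nat) :
  2^-1 <= p -> (forall i, (0 < i)%N -> (0 < a i)%N) ->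
  (cf_sum a n)%:R / expR (n%:R `^ p) @[n --> \oo] --> (1 : R) ->
  exists2 n, (n0 <= n)%N &
    expR (M%:R * n%:R) <= \prod_(k <- prefix_of a n) (k%:R : R).
Proof.
move=> hp a0 Sphi.
pose L := (12 * M + 12)%N; pose l : R := L%:R.
have l12 : 12 <= l by rewrite /l ler_nat leq_addl.
have lM : l = 12 * M%:R + 12 by rewrite /l natrD natrM.
pose e := (12 * l)^-1.
have e0 : 0 < e by rewrite invr_gt0; lra.
pose phi n : R := expR (n%:R `^ p).
have phi0 n : 0 < phi n by exact: expR_gt0.
have [n1 _ Sn] : \forall n \near \oo, `|1 - (cf_sum a n)%:R / phi n| < e.
  by move/cvgrPdist_lt : Sphi; apply.
have {}Sn n : (n1 <= n)%N ->
    (1 - e) * phi n <= (cf_sum a n)%:R <= (1 + e) * phi n.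
  move=> /Sn /=; rewrite -(ler_pdivlMr _ _ (phi0 n)) -(ler_pdivrMr _ _ (phi0 n)).
  by rewrite ltr_distl => /andP[? ?]; apply/andP; split; lra.
pose P := (n0 + n1 + 24)%N; pose q : R := P%:R.
have q24 : 24 <= q by rewrite /q ler_nat leq_addl.
pose N := (L ^ 2 * P ^ 2)%N.
have NE : N%:R = (l * q) ^+ 2 :> R by rewrite natrM !natrX exprMn.
have P_le_N : (P <= N)%N.
  rewrite /N -[leqLHS]mul1n; apply: leq_mul; first by rewrite expn_gt0 addn_gt0 orbT.
  by rewrite -[leqLHS]expn1 leq_pexp2l// /P addn_gt0 orbT.
have n0N : (n0 <= N)%N by apply: leq_trans P_le_N; rewrite /P -addnA leq_addr.
have n1N : (n1 <= N)%N.
  by apply: leq_trans P_le_N; rewrite /P addnAC leq_addl.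
pose b i : R := (a i * a i.+1)%:R.
have b1 i : (0 < i)%N -> 1 <= b i by move=> i0; rewrite ler1n muln_gt0 !a0.
have window n : (N <= n)%N -> (n + P <= 2 * N)%N ->
    expR (l * q / 2) <= \prod_(n.+1 <= i < (n + P).+1) (2 * b i).
  move=> Nn nP.
  apply: le_trans (sum_lt_prod b n.+1 (n + P).+1 _ _); last first.
  - by rewrite ltnS leq_addr.
  - by move=> i ni; apply: b1; apply: leq_trans ni.
  have -> : \sum_(n.+1 <= i < (n + P).+1) b i
      = (cf_sum a (n + P))%:R - (cf_sum a n)%:R.
    rewrite /cf_sum (@big_cat_nat _ _ _ n.+1 1 (n + P).+1)//=; last first.
      by rewrite ltnS leq_addr.
    by rewrite natrD addrAC subrr add0r natr_sum.
  have /andP[S1 _] := Sn (n + P)%N (leq_trans n1N (leq_trans Nn (leq_addr _ _))).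
  have /andP[_ S2] := Sn n (leq_trans n1N Nn).
  have xN : (l * q) ^+ 2 <= n%:R by rewrite -NE ler_nat.
  have xqN : n%:R + q <= 2 * (l * q) ^+ 2 by rewrite -NE -natrD -natrM ler_nat.
  have := exp_powR_window p l q n%:R hp l12 q24 xN xqN.
  rewrite -natrD -/(phi n) -/(phi (n + P)%N) -/e => /le_trans; apply.
  by apply: le_trans (lerB S1 S2) _; rewrite lerDr.
have windows j : (j <= L ^ 2 * P)%N ->
    expR (l * q / 2) ^+ j <= \prod_(N.+1 <= i < (N + j * P).+1) (2 * b i).
  elim: j => [|j IH] jL; first by rewrite addn0 big_geq.
  rewrite (@big_cat_nat _ _ _ (N + j * P).+1)//=; last 2 first.
  - by rewrite ltnS leq_addr.
  - by rewrite ltnS leq_add2l leq_mul2r leqnSn orbT.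
  rewrite exprSr; apply: ler_pM; rewrite ?exprn_ge0 ?expR_ge0//.
    by apply: IH; exact: ltnW.
  rewrite mulSnr addnA; apply: window; first exact: leq_addr.
  rewrite -addnA -mulSnr mul2n -addnn leq_add2l /N expnS expn1 mulnA.
  by rewrite leq_mul2r jL orbT.
have := windows _ (leqnn _).
have -> : (N + L ^ 2 * P * P = 2 * N)%N by rewrite mul2n -addnn /N expnS expn1 mulnA.
rewrite -expRM_natr natrM natrX -/l -/q big_split/=.
rewrite big_const_nat iter_mulr mulr1 subSS mul2n -addnn addnK => big.
have two : (2 : R) ^+ N <= expR N%:R.
  rewrite -[N%:R]mulr1 expRM_natl lerXn2r ?nnegrE ?expR_ge0//.
  by apply: le_trans (expR_ge1Dx _); lra.
pose Q : R := \prod_(1 <= i < (2 * N + 1).+1) (a i)%:R.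
(* The a_i and the a_{i+1} each form a subproduct of [Q]; the last term involves a_{2N+1}, hence the
   witness 2 N + 1 below. *)
have bQ : \prod_(N.+1 <= i < (N + N).+1) b i <= Q ^+ 2.
  rewrite /b -natr_prod /Q -natr_prod -natrX ler_nat big_split/= expnS expn1.
  have <- : (\prod_(N.+2 <= i < (N + N).+2) a i = \prod_(N.+1 <= i < (N + N).+1) a i.+1)%N.
    by rewrite big_add1.
  by apply: leq_mul; apply: prod_nat_widen => //; rewrite ?mul2n -?addnn ?addn1 !ltnS ?leq_addr// leqW.
exists (2 * N + 1)%N; first by rewrite mul2n -addnn -addnA (leq_trans n0N)// leq_addr.
rewrite big_map (_ : iota 1 _ = index_iota 1 (2 * N + 1).+1); last by rewrite /index_iota subn1.
rewrite -/Q -ler_sqr ?nnegrE ?expR_ge0//; last by apply: prodr_ge0.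
apply: le_trans bQ.
set B := \prod_(_ <= _ < _) _ in big *.
have B0 : 0 <= B by apply: prodr_ge0 => i _; rewrite ler0n.
have {}big : expR (l * q / 2 * (l ^+ 2 * q)) <= expR N%:R * B.
  by apply: le_trans big _; rewrite ler_wpM2r.
have N1 : 1 <= N%:R :> R by rewrite ler1n (leq_trans _ P_le_N)// /P addn_gt0 orbT.
rewrite -expRM_natr; move: big.
rewrite -ler_pdivrMl ?expR_gt0// -expRN -expRD; apply: le_trans.
rewrite ler_expR natrD natrM.
rewrite (_ : l * q / 2 * (l ^+ 2 * q) = l / 2 * N%:R); last by rewrite NE; ring.
rewrite lM; have : 0 <= M%:R :> R by [].
by nra.
Qed.

(** * Hausdorff measure: Hoelder maps onto an interval *)

(** The points that [G] sends into a set of diameter D lie in an interval of length 2 C D^s. Were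
    the measure 0, some cover would have gauge sum below 1 / (2 C), and [0, 1) would be covered by
    intervals of total length below 1. *)
Lemma hausdorff_measure_holder_neq0 {R : realType} (s C : R) (E : set R)
    (G : R -> R) : 0 <= s -> 0 < C ->
  (forall u, 0 <= u < 1 -> E (G u)) ->
  (forall u v, 0 <= u < 1 -> 0 <= v < 1 -> `|u - v| <= C * `|G u - G v| `^ s) ->
  hausdorff_measure s E != 0%E.
Proof.
move=> s0 C0 EG Gs; apply/eqP => H0.
have C2 : 0 < 2 * C by rewrite mulr_gt0.
have : (hausdorff_premeasure s 1 E < ((2 * C)^-1)%:E)%E.
  apply: (@le_lt_trans _ _ 0%E); last by rewrite lte_fin invr_gt0.
  by rewrite -H0; apply: ereal_sup_ubound; exists 1 => /=.
move/ereal_inf_lt => [_ [U [EU U1] <-]] Ulow.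
have cover i : exists J : set R, [/\ measurable J,
    (forall u, 0 <= u < 1 -> U i (G u) -> J u) &
    (lebesgue_measure J <= (2 * C)%:E * hausdorff_gauge s (U i))%E].
  have [[u0 [u0I Uu0]]|none] := pselect (exists u, 0 <= u < 1 /\ U i (G u)); last first.
    exists set0; split => //.
    - by move=> u uI Uu; apply: none; exists u.
    - by rewrite measure0 mule_ge0 ?hausdorff_gauge_ge0// lee_fin ltW.
  have dfin : diam (U i) = (fine (diam (U i)))%:E.
    by rewrite fineK// ge0_fin_numE ?diam_ge0// (le_lt_trans (U1 i)) ?ltry.
  set D := fine _ in dfin.
  have D0 : 0 <= D by rewrite -lee_fin -dfin diam_ge0.
  have -> : hausdorff_gauge s (U i) = (D `^ s)%:E.
    rewrite /hausdorff_gauge; case: ifPn => [/eqP U0|_]; first by rewrite U0 in Uu0.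
    by rewrite dfin poweR_EFin.
  (* An interval around one point replaces the preimage of [U i], which need not be measurable. *)
  exists `[u0 - C * D `^ s, u0 + C * D `^ s]%classic; split => //.
    move=> u uI Uu /=; rewrite in_itv/= -ler_distlC.
    apply: le_trans (Gs _ _ u0I uI) _; rewrite ler_pM2l//.
    apply: ge0_ler_powR => //; rewrite ?nnegrE//.
    rewrite -lee_fin -dfin; apply: ereal_sup_ubound; right.
    by exists (G u0, G u).
  rewrite lebesgue_measure_itv/=; case: ifPn => _.
    by rewrite -EFinB -EFinM lee_fin; lra.
  by rewrite mule_ge0// lee_fin ?powR_ge0// ltW.
have [J JP] := choice cover.
have : (lebesgue_measure (`[0%R, 1%R[%classic : set R) <= \sum_(0 <= i <oo) lebesgue_measure (J i))%E.
  apply: measure_sigma_subadditive => //.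
  - by move=> i; case: (JP i).
  - move=> u /=; rewrite in_itv/= => uI.
    have [i _ Ui] := EU _ (EG u uI).
    by exists i => //; case: (JP i) => _ + _; apply.
rewrite lebesgue_measure_itv/= lte_fin ltr01 sube0; apply/negP; rewrite -ltNge.
apply: (@le_lt_trans _ _ (\sum_(0 <= i <oo) ((2 * C)%:E * hausdorff_gauge s (U i)))%E).
  by apply: lee_nneseries => [i _ _|i _]; [exact: measure_ge0|case: (JP i)].
rewrite nneseriesZl; last by move=> i _; exact: hausdorff_gauge_ge0.
by rewrite muleC -lte_pdivlMr// mul1e.
Qed.

(** * Expansions with partial quotients at least 2 *)

Lemma prefixS (a : nat -> nat) n :
  prefix_of a n.+1 = a 1%N :: prefix_of (fun i => a i.+1) n.
Proof. by rewrite /= (iotaDl 1 1 n) -map_comp. Qed.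

(** Each partial quotient is at least 2 and contracts by at least 1/4, so all convergents after the
    n-th lie within 2^(-n) of it and the sequence is Cauchy. *)
Lemma cf_expansion_exists (R : realType) (a : nat -> nat) :
  (forall i, (0 < i)%N -> (1 < a i)%N) -> exists x : R, cf_expansion x a.
Proof.
move=> a1; have a0 i : (0 < i)%N -> (0 < a i)%N by move=> /a1 /ltnW.
suff : cvg (cfrac R [seq a i | i <- iota 1 n] @[n --> \oo]).
  by move=> /cvg_ex[x cx]; exists x; split.
apply: cauchy_cvg; apply: cauchy_exP => e e0.
have [n ne] := exists_small_geo (e / 2) ltac:(by rewrite divr_gt0).
exists (cfrac R [seq a i | i <- iota 1 n]).
suff : \forall m \near \oo, `|cfrac R (prefix_of a n) - cfrac R (prefix_of a m)| < e by [].
near=> m.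
have nm : (n <= m)%N by near: m; exact: nbhs_infty_ge.
rewrite -(subnKC nm) iotaD map_cat cfrac_cat distrC.
have xI : 0 <= cfrac R [seq a i | i <- iota (1 + n) (m - n)] <= 1.
  apply: cfrac_itv; apply/allP => _ /mapP[i + ->].
  by rewrite mem_iota => /andP[i1 _]; apply: a0; exact: leq_trans i1.
have I0 : 0 <= (0 : R) <= 1 by rewrite lexx ler01.
apply: le_lt_trans (cf_map_contract _ _ _ (prefix_gt0 a n a0) xI I0) _.
apply: (@le_lt_trans _ _ (2^-1 ^+ n)); last by apply: le_lt_trans ne _; lra.
rewrite -[leRHS]mul1r; apply: ler_pM => //.
- by apply: prodr_ge0 => i _; rewrite invr_ge0 exprn_ge0.
- by rewrite subr0 ger0_norm; case/andP: xI.
rewrite big_map.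
have -> : 2^-1 ^+ n = \prod_(i <- iota 1 n) 2^-1 :> R.
  by rewrite big_const_seq count_predT size_iota iter_mulr mulr1.
rewrite big_seq [leRHS]big_seq.
apply: ler_prod => i; rewrite mem_iota => /andP[/a1 ai _].
have ai2 : 2 <= (a i)%:R :> R by rewrite ler_nat.
by rewrite invr_ge0 exprn_ge0//= lef_pV2 ?posrE//; nra.
Unshelve. all: by end_near. Qed.

Lemma cf_expansion_itv {R : realType} (x : R) (a : nat -> nat) :
  cf_expansion x a -> 0 <= x <= 1.
Proof.
move=> [a0 ax].
have cI n := @cfrac_itv R _ (prefix_gt0 a n a0).
apply/andP; split.
  apply: (ler_cvg_to (cvg_cst (0 : R)) ax); apply: nearW => n.
  by case/andP: (cI n).
apply: (ler_cvg_to ax (cvg_cst (1 : R))); apply: nearW => n.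
by case/andP: (cI n).
Qed.

Lemma cf_expansion_shift {R : realType} (x y : R) (a : nat -> nat) :
  cf_expansion x a -> cf_expansion y (fun i => a i.+1) ->
  x = ((a 1%N)%:R + y)^-1.
Proof.
move=> [a0 ax] hy; have /andP[y0 _] := cf_expansion_itv y _ hy.
have a1 : 1 <= (a 1%N)%:R :> R by rewrite ler1n a0.
move: ax; rewrite -cvg_shiftS => ax; apply: (cvg_unique _ ax) => //.
have -> : [sequence cfrac R (prefix_of a n.+1)]_n
  = (fun n => ((a 1%N)%:R + cfrac R (prefix_of (fun i => a i.+1) n))^-1).
  by apply/funext => n; exact: (congr1 (cfrac R) (prefixS a n)).
apply: cvgV; first by apply/eqP; lra.
by apply: cvgD; [exact: cvg_cst|case: hy].
Qed.

(** The bound 1/2 on the tail comes from its first partial quotient being at least 2; it keeps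
    cylinders with different first quotients apart. *)
Lemma cf_expansion_tail (R : realType) (x : R) (a : nat -> nat) :
  (forall i, (0 < i)%N -> (1 < a i)%N) -> cf_expansion x a ->
  exists y : R, [/\ cf_expansion y (fun i => a i.+1), 0 < y <= 2^-1 &
    x = ((a 1%N)%:R + y)^-1].
Proof.
have half (z : R) (b : nat -> nat) : (forall i, (0 < i)%N -> (1 < b i)%N) ->
    cf_expansion z b -> 0 < z <= 2^-1.
  move=> b1 zb; have [y yb] := cf_expansion_exists R (fun i => b i.+1)
    (fun i _ => b1 i.+1 isT).
  have /andP[y0 y1] := cf_expansion_itv y _ yb.
  have b2 : 2 <= (b 1%N)%:R :> R by rewrite ler_nat b1.
  rewrite (cf_expansion_shift z y b zb yb) invr_gt0.
  by rewrite lef_pV2 ?posrE//; [apply/andP; split|]; lra.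
move=> a1 xa; have a1' i : (0 < i)%N -> (1 < a i.+1)%N by move=> _; exact: a1.
have [y yb] := cf_expansion_exists R (fun i => a i.+1) a1'.
by exists y; split; [|exact: half yb|exact: cf_expansion_shift].
Qed.

Lemma cf_expansion_lt1 (R : realType) (x : R) (a : nat -> nat) :
  (forall i, (0 < i)%N -> (1 < a i)%N) -> cf_expansion x a -> 0 < x < 1.
Proof.
move=> a1 xa; have [y [_ /andP[y0 y1] ->]] := cf_expansion_tail R x a a1 xa.
have a2 : 2 <= (a 1%N)%:R :> R by rewrite ler_nat a1.
by rewrite invr_gt0 invf_lt1; [apply/andP; split|]; lra.
Qed.

(* If x = m / q then the tail y = 1 / x - a 1 has denominator m < q, so
   rationality contradicts descent on the denominator. *)
Lemma cf_expansion_irrational (R : realType) (x : R) (a : nat -> nat) :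
  (forall i, (0 < i)%N -> (1 < a i)%N) -> cf_expansion x a -> irrational x.
Proof.
move=> a1 xa /rationalP[m [q xq]].
have /andP[xpos _] := cf_expansion_lt1 R x a a1 xa.
have q0 : q%:R != 0 :> R by apply/eqP => q0; move: xpos; rewrite xq q0 invr0 mulr0 ltxx.
have [k] : exists k : nat, x * q%:R = k%:R.
  have m0 : 0 <= m by rewrite -(ler0z R) -(divfK q0 m%:~R) -xq mulr_ge0// ltW.
  by exists `|m|%N; rewrite xq divfK// natr_absz ger0_norm.
move: q0; rewrite pnatr_eq0 -lt0n => {xpos} q0 xk; move: q0 xk {m xq}.
elim/ltn_ind: q x a k a1 xa => q IH x a m a1 xa q0 xq.
have /andP[x0 x1] := cf_expansion_lt1 R x a a1 xa.
have [y [ya _ xE]] := cf_expansion_tail R x a a1 xa.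
have a1' i : (0 < i)%N -> (1 < a i.+1)%N by move=> _; exact: a1.
have /andP[y0 _] := cf_expansion_lt1 R y _ a1' ya.
have a2 : 2 <= (a 1%N)%:R :> R by rewrite ler_nat a1.
have q1 : 0 < q%:R :> R by rewrite ltr0n.
have mq : (m < q)%N by rewrite -(ltr_nat R) -xq gtr_pMl.
have m0 : (0 < m)%N by rewrite -(ltr0n R) -xq mulr_gt0.
have yq : y * m%:R = q%:R - (a 1%N)%:R * m%:R.
  rewrite -xq xE; field; lra.
apply: (IH m mq y (fun i => a i.+1) (q - a 1%N * m)%N a1' ya m0).
rewrite natrB ?natrM// -(ler_nat R) natrM -subr_ge0 -yq.
by rewrite mulr_ge0// ltW.
Qed.

(** Where the quotients first differ, the denominators differ by at least 1 - 1/2, since the tails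
    lie in (0, 1/2]. Each level, common or not, divides the distance by a product of two
    denominators, at most (A i)^2. *)
Lemma cf_expansion_separated (R : realType) (A a b : nat -> nat) n (x y : R) :
  (forall i, (0 < i)%N -> (1 < a i)%N /\ (1 < b i)%N) ->
  (forall i, (0 < i)%N -> (a i < A i)%N /\ (b i < A i)%N) ->
  cf_expansion x a -> cf_expansion y b ->
  (forall i, (0 < i)%N -> (i < n.+1)%N -> a i = b i) -> a n.+1 != b n.+1 ->
  2^-1 * \prod_(1 <= i < n.+2) ((A i)%:R ^- 2) <= `|x - y|.
Proof.
move=> ab1 abA xa yb.
elim: n A a b x y ab1 abA xa yb => [|n IH] A a b x y ab1 abA xa yb ab abn.
all: have [x' [xa' /andP[x0 x1] ->]] := cf_expansion_tail R x a (fun i i0 => proj1 (ab1 i i0)) xa.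
all: have [y' [yb' /andP[y0 y1] ->]] := cf_expansion_tail R y b (fun i i0 => proj2 (ab1 i i0)) yb.
all: have [a1A b1A] := abA 1%N isT.
all: have {}a1A : 1 + (a 1%N)%:R <= (A 1%N)%:R :> R by rewrite nat1r ler_nat.
all: have {}b1A : 1 + (b 1%N)%:R <= (A 1%N)%:R :> R by rewrite nat1r ler_nat.
all: have [a10 b10] : 0 <= (a 1%N)%:R :> R /\ 0 <= (b 1%N)%:R :> R by split.
all: set ra := (a 1%N)%:R in a1A a10 *; set rb := (b 1%N)%:R in b1A b10 *.
all: set rA := (A 1%N)%:R in a1A b1A.
all: have inv : rA ^- 2 <= ((ra + x') * (rb + y'))^-1.
all: try by rewrite lef_pV2 ?posrE; nra.
all: rewrite dist_inv; try lra.
- rewrite big_nat1; apply: ler_pM => //.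
  have : 1 <= `|ra - rb|.
    rewrite /ra /rb; have [lt|lt|eq] := ltngtP (a 1%N) (b 1%N).
    - by rewrite distrC ger0_norm ?subr_ge0 ?ler_nat 1?ltnW// lerBrDl natr1 ler_nat.
    - by rewrite ger0_norm ?subr_ge0 ?ler_nat 1?ltnW// lerBrDl natr1 ler_nat.
    - by rewrite eq eqxx in abn.
  rewrite (_ : ra - rb = (ra + x' - (rb + y')) + (y' - x')); last by ring.
  have : `|y' - x'| <= 2^-1 by rewrite ler_distl; lra.
  have := ler_normD (ra + x' - (rb + y')) (y' - x'); lra.
rewrite big_nat_recl//= mulrCA mulrC.
have -> : ra = rb by rewrite /ra /rb ab.
rewrite (_ : _ - _ = x' - y'); last by ring.
apply: ler_pM.
- by rewrite mulr_ge0// prodr_ge0// => i _; rewrite invr_ge0 exprn_ge0.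
- by rewrite invr_ge0 exprn_ge0// ltW//; lra.
- apply: (IH (fun i => A i.+1) _ _ x' y' _ _ xa' yb') => // i i0.
  + exact: ab1.
  + exact: abA.
  + by move=> ilt; exact: ab.
- by move: inv; have -> : ra = rb by rewrite /ra /rb ab.
Qed.

(** * Blocks of partial quotients *)

Lemma is_derive_exp_powR {R : realType} (p t : R) : 0 < t ->
  is_derive t 1 (fun u => expR (u `^ p)) (expR (t `^ p) * (p * t `^ (p - 1))).
Proof.
move=> t0; apply: (@is_derive1_comp _ expR (fun u => u `^ p)).
exact: is_derive1_powR.
Qed.

(* Up to a common factor [p], the derivatives of [expR (u `^ p)] at [t] and
   [t + 1] are compared. *)
Lemma exp_powR_derive_growth {R : realType} (p t : R) : 2^-1 <= p -> 5 <= t ->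
  Num.sqrt ((t + 1) / t) * (expR (t `^ p) * t `^ (p - 1))
  <= expR ((t + 1) `^ p) * (t + 1) `^ (p - 1).
Proof.
move=> hp t5; have t0 : 0 < t by lra.
have t10 : 0 < t + 1 by lra.
pose c := (t + 1) / t.
have c0 : 0 < c by rewrite divr_gt0.
have c1 : 1 <= c by rewrite /c ler_pdivlMr// mul1r; lra.
have tE : (t + 1) `^ (p - 1) = t `^ (p - 1) * c `^ (p - 1).
  by rewrite -powRM ?ltW// mulrCA divff ?mulr1// gt_eqF.
have -> : expR ((t + 1) `^ p) = expR (t `^ p) * expR ((t + 1) `^ p - t `^ p).
  by rewrite -expRD; congr expR; ring.
rewrite tE mulrC -!mulrA ler_pM2l ?expR_gt0// mulrCA ler_pM2l ?powR_gt0//.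
rewrite -/c -powR12_sqrt; last exact: ltW.
have h1 : c `^ (- 2^-1) <= c `^ (p - 1) by apply: ler_powR => //; lra.
(* The power factor costs at most c^(-1/2), so a gain of c from the exponential leaves sqrt c. *)
suff h2 : c <= expR ((t + 1) `^ p - t `^ p).
  apply: (@le_trans _ _ (c * c `^ (- 2^-1))); last first.
    by apply: ler_pM => //; [exact: ltW|exact: powR_ge0].
  rewrite -[X in X * _](powRr1 (ltW c0)) -powRD; last by apply/implyP => _; rewrite gt_eqF.
  by rewrite (_ : 1 + - 2^-1 = 2^-1)//; lra.
rewrite -[c]lnK ?posrE// ler_expR.
apply: (@le_trans _ _ t^-1).
  rewrite (_ : c = 1 + t^-1); first by apply: le_ln1Dx; apply: lt_trans (_ : 0 < _); rewrite ?invr_gt0//; lra.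
  by rewrite /c; field; lra.
have t1 : 1 <= t by lra.
have tt1 : t <= t + 1 by lra.
apply: le_trans (powR_increment p t (t + 1) hp t1 tt1).
rewrite -div1r; apply: sqrt_increment; [lra|exact: ler01|exact: t0|].
(* t >= 5 ensures t + 1 <= (t / 2)^2. *)
suff h z : z <= t + 1 -> Num.sqrt z <= t / 2.
  by have := h _ (lexx _); have := h t tt1; lra.
by move=> zt; apply: sqrt_le; nra.
Qed.

(** Rearranged, this is f(n - 1) <= f(n) for f(t) = e^((t+1)^p) - c e^(t^p). The derivative of f is
    nonnegative there, since c is at most sqrt((t + 1) / t) for t <= n. *)
Lemma exp_powR_diff_growth {R : realType} (p : R) n : 2^-1 <= p -> (6 <= n)%N ->
  Num.sqrt (n.+1%:R / n%:R) * (expR (n%:R `^ p) - expR (n.-1%:R `^ p))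
  <= expR (n.+1%:R `^ p) - expR (n%:R `^ p).
Proof.
move=> hp n6.
have n6R : 6 <= n%:R :> R by rewrite ler_nat.
pose x : R := n.-1%:R.
have -> : n.-1%:R = x by [].
have nE : n%:R = x + 1 :> R by rewrite natr1 prednK//; apply: leq_trans n6.
have -> : n.+1%:R = x + 1 + 1 :> R by rewrite -nE natr1.
rewrite nE in n6R *.
have x5 : 5 <= x by lra.
set c := Num.sqrt _.
pose f (t : R) := expR ((t + 1) `^ p) - c * expR (t `^ p).
suff : f x <= f (x + 1).
  rewrite /f; move: (expR ((x + 1 + 1) `^ p)) (expR ((x + 1) `^ p)) => U V.
  by rewrite mulrBr; lra.
have factor (U V X Y k : R) : k * (U * X) <= V * Y ->
    0 <= V * (p * Y) - k * (U * (p * X)).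
  move=> h; rewrite (_ : _ - _ = p * (V * Y - k * (U * X))); last by ring.
  by apply: mulr_ge0; lra.
have fd (t : R) : 0 < t -> is_derive t 1 f (expR ((t + 1) `^ p) * (p * (t + 1) `^ (p - 1))
    - c * (expR (t `^ p) * (p * t `^ (p - 1)))).
  move=> t0; apply: is_deriveB.
    rewrite -[X in is_derive _ _ _ X]mulr1.
    apply: (@is_derive1_comp _ (fun u => expR (u `^ p)) (fun u => u + 1)).
      by apply: is_derive_exp_powR; lra.
    rewrite -[X in is_derive _ _ _ X]addr0.
    by apply: is_deriveD.
  by apply: is_deriveZ; exact: is_derive_exp_powR.
apply: (@ger0_derive1_ndecr _ f x (x + 1)) => //; last by lra.
- by move=> t; rewrite in_itv/= => /andP[xt _]; apply: ex_derive; apply: fd; lra.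
- move=> t; rewrite in_itv/= => /andP[xt tx].
  rewrite derive1E; have t0 : 0 < t by lra.
  have -> := @derive_val _ _ _ _ _ _ _ (fd t t0).
  have t5 : 5 <= t by lra.
  have cle : c <= Num.sqrt ((t + 1) / t).
    rewrite ler_wsqrtr// ler_pdivrMr; last lra.
    by rewrite mulrAC ler_pdivlMr//; nra.
  have X0 : 0 <= expR (t `^ p) * t `^ (p - 1) by rewrite mulr_ge0 ?expR_ge0 ?powR_ge0.
  have := exp_powR_derive_growth p t hp t5.
  have := ler_wpM2r X0 cle.
  by move=> h1 h2; apply: factor; exact: le_trans h1 h2.
- apply: derivable_within_continuous => t; rewrite in_itv/= => /andP[xt _].
  by apply: ex_derive; apply: fd; lra.
Qed.

(** Stated with steps of two because [exp_weight] is controlled only along indices of equal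
    parity. *)
Lemma two_step_lbound {R : realType} (u : nat -> R) (n0 : nat) :
  (forall n, 0 < u n) -> (forall n, (n0 <= n)%N -> u n <= u n.+2) ->
  exists2 k : R, 0 < k & forall n, k <= u n.
Proof.
move=> u0 uS; exists (\big[Num.min/1]_(i < n0.+2) u i).
  by elim/big_ind : _ => // x y x0 y0; rewrite lt_min x0.
move=> n; have [m] := ubnP n; elim: m n => // m IH n nm.
have [n2|n2] := ltnP n n0.+2; first exact: (bigmin_le_cond _ _ (j := Ordinal n2)).
case: n n2 nm => [|[|n]]// n2 nm.
by apply: le_trans (uS n n2); apply: IH; rewrite ltnS in nm; exact: ltnW.
Qed.

Definition exp_diff {R : realType} (p : R) (n : nat) : R :=
  expR (n%:R `^ p) - expR (n.-1%:R `^ p).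

(* The approximate size of the [n]-th partial quotient, [n >= 1]; the value at
   0 is junk making [exp_weight p 1 = 1]. *)
Fixpoint exp_weight {R : realType} (p : R) (n : nat) : R :=
  if n is n'.+1 then (if n' is 0%N then 1 else exp_diff p n') / exp_weight p n'
  else 1.

Lemma exp_diff_gt0 {R : realType} (p : R) n : 0 < p -> (0 < n)%N ->
  0 < exp_diff p n.
Proof.
move=> p0 n0; rewrite subr_gt0 ltr_expR; apply: gt0_ltr_powR => //.
- by rewrite nnegrE.
- by rewrite nnegrE.
- by rewrite ltr_nat prednK.
Qed.

Lemma exp_weight_gt0 {R : realType} (p : R) n : 0 < p -> 0 < exp_weight p n.
Proof.
move=> p0; elim: n => [|[|n] IH] //=.
by rewrite divr_gt0// exp_diff_gt0.
Qed.

Lemma exp_weightM {R : realType} (p : R) n : 0 < p -> (0 < n)%N ->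
  exp_weight p n * exp_weight p n.+1 = exp_diff p n.
Proof.
case: n => // n p0 _; have -> : exp_weight p n.+2 = exp_diff p n.+1 / exp_weight p n.+1 by [].
by rewrite mulrC divfK// gt_eqF// exp_weight_gt0.
Qed.

(** w_{m+2} / w_m is a ratio of consecutive increments, at least sqrt((m + 1) / m). Its fourth power
    is at least (m + 2) / m, so w_m^4 / m does not decrease in steps of two. *)
Lemma exp_weight_growth {R : realType} (p : R) : 2^-1 <= p ->
  exists2 k : R, 0 < k & forall n, (0 < n)%N -> k * n%:R <= exp_weight p n ^+ 4.
Proof.
move=> hp; have p0 : 0 < p by lra.
have w0 n := @exp_weight_gt0 R p n p0.
have [||k k0 kP] := two_step_lbound (fun n => exp_weight p n.+1 ^+ 4 / n.+1%:R) 5.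
- by move=> n; rewrite divr_gt0// exprn_gt0.
- move=> n n5; set m := n.+1; have m0 : 0 < m%:R :> R by rewrite ltr0n.
  have wE : exp_weight p m.+2 = exp_diff p m.+1 / exp_diff p m * exp_weight p m.
    rewrite -(exp_weightM p m p0 isT) -(exp_weightM p m.+1 p0 isT).
    by field; rewrite !gt_eqF.
  have := exp_powR_diff_growth p m hp n5.
  rewrite -[expR _ - expR (m%:R `^ p)]/(exp_diff p m.+1) -/(exp_diff p m).
  set c := Num.sqrt _ => h.
  have c2 : c ^+ 2 = m.+1%:R / m%:R by rewrite sqr_sqrtr// divr_ge0.
  have c0 : 0 <= c by exact: sqrtr_ge0.
  have {}h : c <= exp_diff p m.+1 / exp_diff p m.
    by rewrite ler_pdivlMr ?exp_diff_gt0.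
  change (exp_weight p m ^+ 4 / m%:R <= exp_weight p m.+2 ^+ 4 / m.+2%:R).
  move: (w0 m); rewrite wE; move: (exp_weight p m) => u u0.
  rewrite exprMn; have v0 : 0 <= u ^+ 4 by rewrite exprn_ge0// ltW.
  rewrite ler_pdivlMr ?ltr0n// mulrAC ler_pdivrMr// mulrC [leRHS]mulrAC.
  apply: ler_wpM2r => //.
  have : c ^+ 4 <= (exp_diff p m.+1 / exp_diff p m) ^+ 4.
    by rewrite lerXn2r// nnegrE// (le_trans c0).
  rewrite (exprM c 2 2) c2.
  set q := _ ^+ 4 => hq; apply: (le_trans _ (ler_wpM2r (ltW m0) hq)).
  rewrite -[m.+2%:R]natr1 -[m.+1%:R]natr1.
  rewrite (_ : _ * m%:R = m%:R + 2 + m%:R^-1); last by field; lra.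
  by have := m0; rewrite -invr_gt0; lra.
exists k => // -[//|n] _; rewrite -ler_pdivlMr ?ltr0n//; exact: kP.
Qed.

(** The exponent n^p gains at least 1 / (2 n) in the last step, so the increment is a fraction at
    least 1 / (3 n) of the value. *)
Lemma exp_diff_ge {R : realType} (p : R) n : 2^-1 <= p -> (1 < n)%N ->
  expR (n%:R `^ p) <= 3 * n%:R * exp_diff p n.
Proof.
move=> hp n1; rewrite /exp_diff; pose x : R := n.-1%:R.
have -> : n.-1%:R = x by [].
have nE : n%:R = x + 1 :> R by rewrite natr1 prednK// ltnW.
have x1 : 1 <= x by rewrite /x ler1n -ltnS prednK// ltnW.
rewrite nE; set d := (x + 1) `^ p - x `^ p.
have d0 : (2 * (x + 1))^-1 <= d.
  have x1x : x <= x + 1 by lra.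
  apply: le_trans (powR_increment p x (x + 1) hp x1 x1x).
  rewrite -div1r; apply: sqrt_increment; [lra|exact: ler01|lra|].
  suff h z : z <= x + 1 -> Num.sqrt z <= x + 1.
    by have := h _ (lexx _); have := h x x1x; lra.
  by move=> zt; apply: sqrt_le; nra.
have -> : (x + 1) `^ p = x `^ p + d by rewrite /d; ring.
rewrite expRD; have := expR_ge1Dx d; have := expR_gt0 (x `^ p).
set E := expR (x `^ p); set D := expR d => E0 D1.
have : 1 <= d * (2 * (x + 1)) by rewrite -ler_pdivrMr ?div1r//; lra.
move=> dx; have : D <= 3 * (x + 1) * (D - 1) by nra.
by nra.
Qed.

(** With 2 s = 1 - 2 e and (n + 1)^p <= n^p e^(p/n), the left exponent is at most (1 - e) n^p once p
    / n <= e. The spare factor e^(e n^p) is at least (e sqrt n / 8)^8, of order n^4, which beats H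
    n^3. *)
Lemma exp_powR_gap {R : realType} (p s H : R) : 2^-1 <= p -> 0 <= s < 2^-1 ->
  0 < H -> exists n0 : nat, forall n, (n0 <= n)%N ->
    H * n%:R ^+ 3 * expR (2 * s * n.+1%:R `^ p) <= expR (n%:R `^ p).
Proof.
move=> hp /andP[s0 s2] H0; have p0 : 0 < p by lra.
pose e := (1 - 2 * s) / 2; have e0 : 0 < e by rewrite /e; lra.
have e1 : e <= 2^-1 by rewrite /e; lra.
pose B : R := H * 8 ^+ 8 / e ^+ 8.
exists (Num.trunc (p / e) + Num.trunc B).+1 => n nB.
have n0 : 0 < n%:R :> R by rewrite ltr0n; apply: leq_trans nB.
have n1 : 1 <= n%:R :> R by rewrite ler1n -(ltr0n R).
have npe : p <= n%:R * e.
  rewrite -ler_pdivrMr//; apply: ltW; apply: lt_le_trans (truncnS_gt _) _.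
  by rewrite ler_nat (leq_trans _ nB)// ltnS leq_addr.
have nBH : H * 8 ^+ 8 <= n%:R * e ^+ 8.
  rewrite -ler_pdivrMr ?exprn_gt0//; apply: ltW; apply: lt_le_trans (truncnS_gt _) _.
  by rewrite ler_nat (leq_trans _ nB)// ltnS leq_addl.
have {}npe : p / n%:R <= e by rewrite ler_pdivrMr// mulrC.
pose z := expR (p / n%:R).
have zle : 2 * s * z <= 1 - e.
  have z0 : 0 < z by exact: expR_gt0.
  have : z * (1 - p / n%:R) <= 1.
    by rewrite -[leRHS](expRxMexpNx_1 (p / n%:R)) ler_pM2l// expR_ge1Dx.
  have -> : 2 * s = 1 - 2 * e by rewrite /e; field.
  set t := p / n%:R in npe *; have t0 : 0 <= t by rewrite divr_ge0// ltW.
  by nra.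
have np0 : 0 <= n%:R `^ p :> R by exact: powR_ge0.
have nS : (n.+1%:R : R) `^ p <= n%:R `^ p * z.
  have -> : n.+1%:R = n%:R * (1 + n%:R^-1) :> R.
    by rewrite mulrDr mulr1 divff ?natr1// gt_eqF.
  rewrite powRM ?addr_ge0 ?invr_ge0//.
  rewrite ler_wpM2l// /z mulrC expRM.
  apply: ge0_ler_powR.
  - exact: ltW.
  - by rewrite nnegrE addr_ge0 ?invr_ge0.
  - by rewrite nnegrE expR_ge0.
  - exact: expR_ge1Dx.
have sq : Num.sqrt n%:R <= n%:R `^ p :> R.
  by rewrite -powR12_sqrt//; exact: ler_powR.
have big : H * n%:R ^+ 3 <= expR (e * n%:R `^ p).
  apply: (@le_trans _ _ (expR (e * Num.sqrt n%:R))); last first.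
    by rewrite ler_expR ler_pM2l.
  have -> : e * Num.sqrt n%:R = e * Num.sqrt n%:R / 8 * 8%:R by rewrite divfK.
  rewrite expRM_natr; apply: (@le_trans _ _ ((e * Num.sqrt n%:R / 8) ^+ 8)); last first.
    rewrite lerXn2r ?nnegrE ?expR_ge0//.
      by rewrite divr_ge0// mulr_ge0 ?sqrtr_ge0// ltW.
    by apply: le_trans (expR_ge1Dx _); rewrite lerDr.
  rewrite expr_div_n exprMn (exprM (Num.sqrt _) 2 4) sqr_sqrtr//.
  rewrite ler_pdivlMr ?exprn_gt0//.
  rewrite (_ : e ^+ 8 * n%:R ^+ 4 = n%:R * e ^+ 8 * n%:R ^+ 3); last by ring.
  by rewrite mulrAC ler_wpM2r// exprn_ge0.
have -> : expR (n%:R `^ p) = expR (e * n%:R `^ p) * expR ((1 - e) * n%:R `^ p).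
  by rewrite -expRD; congr expR; ring.
apply: ler_pM big _; [|exact: expR_ge0|].
  by apply: mulr_ge0; [exact: ltW|exact: exprn_ge0].
rewrite ler_expR; apply: (@le_trans _ _ (2 * s * (n%:R `^ p * z))).
  by rewrite ler_wpM2l// mulr_ge0.
by rewrite mulrCA mulrA mulrC mulrA mulrC; nra.
Qed.

(** The Stolz-Cesaro theorem: from some N on, the error grows by at most e / 2 times the increment
    of [f], and these bounds telescope. *)
Lemma cesaro_ratio {R : realType} (c f : nat -> R) :
  (forall n, (0 < n)%N -> f n.-1 < f n) ->
  f n @[n --> \oo] --> +oo ->
  c n / (f n - f n.-1) @[n --> \oo] --> (1 : R) ->
  (\sum_(1 <= i < n.+1) c i) / f n @[n --> \oo] --> (1 : R).
Proof.
move=> fS foo cf; apply/cvgrPdist_le => e e0.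
have e2 : 0 < e / 2 by rewrite divr_gt0.
move/cvgrPdist_le : cf => /(_ _ e2)[N _ cN].
pose D n := \sum_(1 <= i < n.+1) c i - f n.
have DS n : (N <= n)%N -> `|D n.+1| <= `|D n| + e / 2 * (f n.+1 - f n).
  move=> Nn; have := cN n.+1 (leqW Nn); rewrite /= => h.
  have f0 : 0 < f n.+1 - f n by rewrite subr_gt0 (fS n.+1).
  rewrite /D big_nat_recr//=.
  rewrite (_ : _ + c n.+1 - f n.+1 = D n - (1 - c n.+1 / (f n.+1 - f n)) * (f n.+1 - f n)); last first.
    by rewrite /D; field; lra.
  apply: le_trans (ler_normB _ _) _; rewrite lerD2l normrM (gtr0_norm f0).
  by rewrite ler_pM2r.
have Dn n : (N <= n)%N -> `|D n| <= `|D N| + e / 2 * (f n - f N).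
  move=> Nn; rewrite -(subnKC Nn); elim: (n - N)%N => [|k IH].
    by rewrite addn0 subrr mulr0 addr0.
  rewrite addnS; apply: le_trans (DS _ (leq_addr _ _)) _; lra.
near=> n.
have Nn : (N <= n)%N by near: n; exact: nbhs_infty_ge.
have f0 : 0 < f n.
  near: n; move/cvgryPgt : foo; exact.
have fbig : (`|D N| + e / 2 * `|f N|) / (e / 2) <= f n.
  by near: n; move/cvgryPge : foo; exact.
rewrite distrC (_ : _ / _ - 1 = D n / f n); last by rewrite /D; field; lra.
rewrite normrM normfV (gtr0_norm f0) ler_pdivrMr//.
apply: le_trans (Dn n Nn) _.
move: fbig; rewrite ler_pdivrMr//.
have := ler_norm (- f N); rewrite normrN => h1 h2; nra.
Unshelve. all: by end_near. Qed.

Lemma cvg_inv_natr {R : realType} : (n%:R : R)^-1 @[n --> \oo] --> (0 : R).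
Proof.
apply/gtr0_cvgV0; last by apply/cvgryPge => A; exact: nbhs_infty_ger.
by near=> n; rewrite ltr0n; near: n; exact: nbhs_infty_gt.
Unshelve. all: by end_near. Qed.

Lemma cvg_exp_powR {R : realType} (p : R) : 2^-1 <= p ->
  expR (n%:R `^ p) @[n --> \oo] --> +oo.
Proof.
move=> hp; apply/cvgryPge => A; near=> n.
have n1 : 1 <= n%:R :> R by near: n; exact: nbhs_infty_ger.
have nA : A ^+ 2 <= n%:R by near: n; exact: nbhs_infty_ger.
have : Num.sqrt n%:R <= n%:R `^ p :> R.
  by rewrite -powR12_sqrt//; exact: ler_powR.
have : `|A| <= Num.sqrt n%:R by rewrite -sqrtr_sqr ler_wsqrtr.
have := ler_norm A; have := expR_ge1Dx (n%:R `^ p : R).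
lra.
Unshelve. all: by end_near. Qed.

Lemma cvg_inv_exp_weight {R : realType} (p : R) : 2^-1 <= p ->
  (exp_weight p n)^-1 @[n --> \oo] --> (0 : R).
Proof.
move=> hp; have p0 : 0 < p by lra.
have [k k0 kP] := exp_weight_growth p hp.
have w0 n := exp_weight_gt0 p n p0.
apply/gtr0_cvgV0; first exact: nearW.
apply/cvgryPge => A; near=> n.
have n0 : (0 < n)%N by near: n; exact: nbhs_infty_gt.
have nA : (`|A| ^+ 4 / k) <= n%:R by near: n; exact: nbhs_infty_ger.
apply: (le_trans (ler_norm A)); rewrite -(@ler_pXn2r _ 4)// ?nnegrE//; last exact: ltW.
by apply: le_trans (kP n n0); rewrite mulrC -ler_pdivrMr.
Unshelve. all: by end_near. Qed.

(** The allowed deviation w_i / i + 3 is o(w_i) because w_i tends to infinity; hence a_i a_{i+1} is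
    asymptotic to w_i w_{i+1}, the increment of phi. *)
Lemma cf_sum_cvg_ratio {R : realType} (p : R) (a : nat -> nat) : 2^-1 <= p ->
  (forall i, (0 < i)%N -> exp_weight p i <= (a i)%:R
     <= exp_weight p i + exp_weight p i / i%:R + 3) ->
  (cf_sum a n)%:R / expR (n%:R `^ p) @[n --> \oo] --> (1 : R).
Proof.
move=> hp aw; have p0 : 0 < p by lra.
have w0 n := exp_weight_gt0 p n p0.
have ratio : (a n)%:R / exp_weight p n @[n --> \oo] --> (1 : R).
  apply: (@squeeze_cvgr _ _ _ _ (fun=> 1)
    (fun n => 1 + n%:R^-1 + 3 * (exp_weight p n)^-1)).
  - near=> n; have n0 : (0 < n)%N by near: n; exact: nbhs_infty_gt.
    have /andP[lo hi] := aw n n0; have wn := w0 n.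
    rewrite ler_pdivlMr// mul1r lo ler_pdivrMr//=.
    apply: le_trans hi _; rewrite le_eqVlt; apply/orP; left; apply/eqP.
    by field; rewrite gt_eqF// gt_eqF// ltr0n.
  - exact: cvg_cst.
  - rewrite [X in _ --> X](_ : _ = 1 + 0 + 3 * 0); last by rewrite mulr0 !addr0.
    exact: (cvgD (cvgD (cvg_cst (1 : R)) cvg_inv_natr)
      (cvgM (cvg_cst (3 : R)) (cvg_inv_exp_weight p hp))).
pose c i : R := (a i * a i.+1)%:R.
have cw : c n / (expR (n%:R `^ p) - expR (n.-1%:R `^ p)) @[n --> \oo] --> (1 : R).
  have h : ((a n)%:R / exp_weight p n) * ((a n.+1)%:R / exp_weight p n.+1)
      @[n --> \oo] --> (1 : R).
    rewrite -[X in _ --> X](mulr1 1); apply: cvgM => //.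
    by move: ratio; rewrite -cvg_shiftS.
  apply: cvg_trans h; apply: near_eq_cvg; near=> n.
  have n0 : (0 < n)%N by near: n; exact: nbhs_infty_gt.
  rewrite -[expR _ - _]/(exp_diff p n) -exp_weightM//.
  by rewrite /c natrM; field; rewrite !gt_eqF.
have := cesaro_ratio c _ _ (cvg_exp_powR p hp) cw.
under eq_fun do rewrite -natr_sum.
apply => n n0; rewrite -subr_gt0; exact: exp_diff_gt0.
Unshelve. all: by end_near. Qed.

(** [W i] starts the i-th block and [r i] is its size. The last clause compares cylinder lengths
    with numbers of words; its left product has one factor more because two points separate at
    quotient n + 1 after n common ones. *)
Lemma exists_quotient_blocks {R : realType} (p s : R) : 2^-1 <= p ->
  0 <= s < 2^-1 ->
  exists (W r : nat -> nat) (C : R), [/\ 0 < C,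
    forall n, (1 < W n)%N /\ (0 < r n)%N,
    forall a, (forall i, (0 < i)%N -> (W i <= a i < W i + r i)%N) ->
      (cf_sum a n)%:R / expR (n%:R `^ p) @[n --> \oo] --> (1 : R) &
    forall n, (\prod_(1 <= i < n.+2) (W i + r i)%:R) `^ (2 * s)
      <= C * \prod_(1 <= i < n.+1) (r i)%:R].
Proof.
move=> hp sI; have p0 : 0 < p by lra.
have /andP[s0 s2] := sI.
pose w := exp_weight p; have w0 n : 0 < w n := exp_weight_gt0 p n p0.
have [k k0 kP] := exp_weight_growth p hp.
pose c := Num.min k 1.
have c0 : 0 < c by rewrite lt_min k0 ltr01.
have cw n : (0 < n)%N -> c <= w n.
  move=> n0; have [w1|w1] := lerP 1 (w n).
    by apply: le_trans w1; rewrite ge_min lexx orbT.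
  rewrite ge_min; apply/orP; left.
  have := kP n n0; rewrite -/(w n) => kw.
  have n1 : 1 <= n%:R :> R by rewrite ler1n.
  apply: (@le_trans _ _ (k * n%:R)); first by rewrite ler_peMr// ltW.
  by apply: le_trans kw _; rewrite ler_iXnr// ltW.
pose W n := (Num.trunc (w n)).+2.
pose r n := (Num.trunc (w n / n%:R)).+1.
have WP n : w n <= (W n)%:R <= w n + 2.
  have /andP[lo hi] := truncn_itv (ltW (w0 n)).
  by rewrite /W -addn2 natrD lerD2r lo andbT; move: hi; rewrite -natr1; lra.
have rP n : w n / n%:R <= (r n)%:R <= w n / n%:R + 1.
  have /truncn_itv/andP[lo hi] : 0 <= w n / n%:R by rewrite divr_ge0// ltW.
  by rewrite (ltW hi) /r -natr1 lerD2r lo.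
pose A n := (W n + r n)%N.
(* A n <= 2 w n + 3, and [c] bounds [w] below, so the constant 3 is absorbed. *)
pose K := 2 + 3 / c.
have K0 : 0 < K by rewrite addr_gt0// divr_gt0.
have AK n : (0 < n)%N -> (A n)%:R <= K * w n.
  move=> n0; rewrite natrD; have /andP[_ h1] := WP n; have /andP[_ h2] := rP n.
  have n1 : 1 <= n%:R :> R by rewrite ler1n.
  have h3 : w n / n%:R <= w n by rewrite ler_pdivrMr ?ler_peMr ?ltr0n// ltW.
  have h4 : 3 <= 3 / c * w n by rewrite mulrAC ler_pdivlMr// ler_pM2l// cw.
  by rewrite /K mulrDl; lra.
have prA n : 0 < \prod_(1 <= i < n) (A i)%:R :> R.
  by apply: prodr_gt0 => i _; rewrite ltr0n addn_gt0.
have prr n : 0 < \prod_(1 <= i < n) (r i)%:R :> R.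
  by apply: prodr_gt0 => i _; rewrite ltr0n.
pose Q n := \prod_(1 <= i < n.+1) (r i)%:R / (\prod_(1 <= i < n.+2) (A i)%:R) `^ (2 * s).
have Q0 n : 0 < Q n by rewrite divr_gt0 ?powR_gt0.
(* 6 is the 3 of [exp_diff_ge] times the 2 of m (m + 1) <= 2 m^2. *)
pose H := 6 * (K ^+ 2) `^ (2 * s).
have H0 : 0 < H by rewrite mulr_gt0// powR_gt0// exprn_gt0.
have [n0 n0P] := exp_powR_gap p s H hp sI H0.
have QS n : (n0.+1 <= n)%N -> Q n <= Q n.+2.
  move=> nn; pose m := n.+1.
  have m1 : (1 < m)%N by rewrite ltnS; apply: leq_trans nn.
  have m0 : (0 < m)%N by [].
  have step : ((A m.+1)%:R * (A m.+2)%:R) `^ (2 * s) <= (r m)%:R * (r m.+1)%:R.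
    have AA : (A m.+1)%:R * (A m.+2)%:R <= K ^+ 2 * exp_diff p m.+1.
      rewrite -exp_weightM// -/(w m.+1) -/(w m.+2).
      rewrite (_ : K ^+ 2 * _ = (K * w m.+1) * (K * w m.+2)); last by ring.
      by apply: ler_pM => //; exact: AK.
    have d1 : exp_diff p m.+1 <= expR (m.+1%:R `^ p).
      by rewrite /exp_diff gerBl expR_ge0.
    have rr : exp_diff p m / (m%:R * m.+1%:R) <= (r m)%:R * (r m.+1)%:R.
      rewrite -exp_weightM// -/(w m) -/(w m.+1) invfM mulrACA.
      by apply: ler_pM; [apply: divr_ge0 => //; exact: ltW|
        apply: divr_ge0 => //; exact: ltW|case/andP: (rP m)|case/andP: (rP m.+1)].
    set Y := (K ^+ 2) `^ (2 * s) in H H0 n0P *.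
    apply: (@le_trans _ _ (Y * expR (2 * s * m.+1%:R `^ p))).
      rewrite (mulrC (2 * s)) expRM -powRM ?expR_ge0 ?exprn_ge0//; last exact: ltW.
      apply: ge0_ler_powR.
      - by rewrite mulr_ge0.
      - by rewrite nnegrE mulr_ge0.
      - by rewrite nnegrE mulr_ge0 ?expR_ge0// exprn_ge0// ltW.
      - by apply: le_trans AA _; rewrite ler_pM2l// exprn_gt0.
    apply: le_trans rr.
    have Y0 : 0 < Y by rewrite powR_gt0// exprn_gt0.
    have mn0 : (n0 <= m)%N by rewrite /m; exact: leqW (ltnW nn).
    have := le_trans (n0P m mn0) (exp_diff_ge p m hp m1).
    have m1R : 1 <= m%:R :> R by rewrite ler1n.
    rewrite ler_pdivlMr ?mulr_gt0 ?ltr0n// /H.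
    move: (expR (2 * s * m.+1%:R `^ p)) (expR_ge0 (2 * s * m.+1%:R `^ p)) => E E0.
    move: (exp_diff p m) => b; rewrite -[m.+1%:R]natr1.
    have YE0 : 0 <= Y * E by rewrite mulr_ge0// ltW.
    rewrite (_ : 6 * Y * _ * E = 3 * m%:R * (2 * (Y * E) * m%:R ^+ 2)); last by ring.
    rewrite ler_pM2l; last by rewrite mulr_gt0// ltr0n.
    apply: le_trans.
    rewrite (_ : 2 * (Y * E) * _ = Y * E * (2 * m%:R ^+ 2)); last by ring.
    by rewrite ler_wpM2l//; move: (m%:R) m1R => z z1; nra.
  have rE : \prod_(1 <= i < n.+3) (r i)%:R
      = \prod_(1 <= i < n.+1) (r i)%:R * ((r m)%:R * (r m.+1)%:R) :> R.
    by rewrite 2?big_nat_recr//= mulrA.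
  have AE : \prod_(1 <= i < n.+4) (A i)%:R
      = \prod_(1 <= i < n.+2) (A i)%:R * ((A m.+1)%:R * (A m.+2)%:R) :> R.
    by rewrite 2?big_nat_recr//= mulrA.
  rewrite /Q rE AE powRM ?mulr_ge0 ?(ltW (prA _))//.
  rewrite invfM mulrACA -/(Q n); apply: ler_peMr; first exact: ltW.
  by rewrite ler_pdivlMr ?mul1r// powR_gt0// mulr_gt0// ltr0n addn_gt0.
have [q q0 qQ] := two_step_lbound Q n0.+1 Q0 QS.
exists W, r, q^-1; split; first by rewrite invr_gt0.
- by move=> n; split.
- move=> a aW; apply: cf_sum_cvg_ratio => // i i0; rewrite -/(w i).
  have /andP[lo hi] := WP i; have /andP[_ hr] := rP i.
  have /andP[aw ar] := aW i i0; apply/andP; split.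
    by apply: le_trans lo _; rewrite ler_nat.
  have : (a i)%:R <= (W i)%:R + (r i)%:R :> R by rewrite -natrD ler_nat ltnW.
  lra.
- move=> n; rewrite ler_pdivlMl// -ler_pdivlMr; last by rewrite powR_gt0.
  exact: qQ.
Qed.

(** * Mixed-radix coding of the unit interval *)

(** For u in [0, 1), the fractional part of r 1 * ... * r n * u. *)
Fixpoint radix_rem {R : realType} (r : nat -> nat) (u : R) (n : nat) : R :=
  if n is n'.+1 then
    let x := (r n'.+1)%:R * radix_rem r u n' in x - (Num.trunc x)%:R
  else u.

(* The [n]-th digit, [n >= 1], of [u] in the mixed radix [r 1, r 2, ...]. *)
Definition radix_digit {R : realType} (r : nat -> nat) (u : R) (n : nat) : nat :=
  Num.trunc ((r n)%:R * radix_rem r u n.-1).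

Lemma radix_rem_itv {R : realType} (r : nat -> nat) (u : R) n :
  0 <= u < 1 -> 0 <= radix_rem r u n < 1.
Proof.
move=> u01; elim: n => // n /andP[h0 h1] /=.
have /truncn_itv : 0 <= (r n.+1)%:R * radix_rem r u n by rewrite mulr_ge0.
by rewrite subr_ge0 -natr1 ltrBlDl.
Qed.

Lemma radix_digit_lt {R : realType} (r : nat -> nat) (u : R) n :
  0 <= u < 1 -> (0 < r n)%N -> (radix_digit r u n < r n)%N.
Proof.
move=> u01 r0; have /andP[h0 h1] := radix_rem_itv r u n.-1 u01.
have /truncn_itv/andP[lo _] : 0 <= (r n)%:R * radix_rem r u n.-1 by rewrite mulr_ge0.
by rewrite -(ltr_nat R); apply: le_lt_trans lo _; rewrite gtr_pMr// ltr0n.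
Qed.

(** Equal digits cancel, so the scaled difference is a difference of remainders, both in [0, 1). *)
Lemma radix_dist {R : realType} (r : nat -> nat) (u v : R) n :
  0 <= u < 1 -> 0 <= v < 1 ->
  (forall i, (0 < i < n.+1)%N -> radix_digit r u i = radix_digit r v i) ->
  `|u - v| * \prod_(1 <= i < n.+1) (r i)%:R <= 1.
Proof.
move=> u01 v01 uv.
suff -> : `|u - v| * \prod_(1 <= i < n.+1) (r i)%:R = `|radix_rem r u n - radix_rem r v n|.
  have /andP[u0 u1] := radix_rem_itv r u n u01.
  have /andP[v0 v1] := radix_rem_itv r v n v01.
  by rewrite ler_norml; apply/andP; split; lra.
elim: n uv => [|n IH] uv; first by rewrite big_geq// mulr1.
rewrite big_nat_recr//= mulrA IH; last first.
  by move=> i /andP[i0 ilt]; apply: uv; rewrite i0 ltnW.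
have := uv n.+1 (ltnSn _); rewrite /radix_digit/= => ->.
rewrite -[(r n.+1)%:R in LHS]ger0_norm// -normrM; congr `|_|; ring.
Qed.

(** * The lower bound and the dimension *)

Lemma powR_unbounded {R : realType} (y B : R) : 0 < y ->
  exists n : nat, B < (2 ^+ n) `^ y.
Proof.
move=> y0; have ly : 0 < y * ln 2 :> R.
  by apply: mulr_gt0 => //; rewrite ln_gt0// ltr1n.
pose n := (Num.trunc (B / (y * ln 2))).+1; exists n.
have : B / (y * ln 2) < n%:R by exact: truncnS_gt.
rewrite ltr_pdivrMr// => Bn; apply: (lt_le_trans Bn).
rewrite -powR_mulrn// -powRrM /powR gt_eqF//.
by apply: le_trans (expR_ge1Dx _); rewrite -mulrA lerDr.
Qed.

(** If u and v first differ at digit n + 1 and P is the product of the first n + 1 block ends, then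
    |u - v| <= C P^(-2t) while |G u - G v| >= P^(-2) / 2; eliminating P gives the Hoelder bound. *)
Lemma hausdorff_measure_E_set_neq0 {R : realType} (p s : R) : 2^-1 <= p ->
  0 <= s < 2^-1 ->
  hausdorff_measure s (E_set (fun n : nat => expR (n%:R `^ p))) != 0%E.
Proof.
(* s may be 0, but recovering u from its digits takes a positive exponent; the bound for [t] gives
   that for [s] since distances are at most 1. *)
move=> hp /andP[s0 s2]; pose t := (s + 2^-1) / 2.
have t0 : 0 < t by rewrite /t; lra.
have t2 : t < 2^-1 by rewrite /t; lra.
have st : s <= t by rewrite /t; lra.
have tI : 0 <= t < 2^-1 by rewrite ltW.
have [W [r [C [C0 Wr ratio PAC]]]] := exists_quotient_blocks p t hp tI.
pose a (u : R) i := (W i + radix_digit r u i)%N.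
have a1 u i : (0 < i)%N -> (1 < a u i)%N.
  by move=> _; case: (Wr i) => Wi _; apply: leq_trans Wi (leq_addr _ _).
have [G GP] := choice (fun u => cf_expansion_exists R (a u) (a1 u)).
have aA (u : R) i : 0 <= u < 1 -> (0 < i)%N -> (W i <= a u i < W i + r i)%N.
  move=> u01 i0; rewrite leq_addr ltn_add2l radix_digit_lt//.
  by case: (Wr i).
have PA0 n : 0 < \prod_(1 <= i < n) (W i + r i)%:R :> R.
  by apply: prodr_gt0 => i _; rewrite ltr0n addn_gt0; case: (Wr i) => /ltnW ->.
have dist (u v : R) n : 0 <= u < 1 -> 0 <= v < 1 ->
    (forall i, (0 < i < n.+1)%N -> radix_digit r u i = radix_digit r v i) ->
    `|u - v| * (\prod_(1 <= i < n.+2) (W i + r i)%:R) `^ (2 * t) <= C.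
  move=> u01 v01 /(radix_dist r u v n u01 v01) h.
  apply: le_trans (ler_wpM2l (normr_ge0 _) (PAC n)) _.
  by rewrite mulrCA ler_piMr// ltW.
have Gitv u : 0 < G u < 1 := cf_expansion_lt1 R _ _ (a1 u) (GP u).
apply: (hausdorff_measure_holder_neq0 s (C * 2 `^ t) _ G) => //.
- by rewrite mulr_gt0// powR_gt0.
- move=> u u01; split => //; first exact: cf_expansion_irrational (a1 u) (GP u).
  by exists (a u); split; [exact: GP|apply: ratio => i; exact: aA].
move=> u v u01 v01.
have [[n nP]|same] := pselect (exists n, radix_digit r u n.+1 != radix_digit r v n.+1).
  have [{}n {}nP nmin] := ex_minnP (ex_intro (fun n => radix_digit r u n.+1 != radix_digit r v n.+1) n nP).
  have agree i : (0 < i < n.+1)%N -> radix_digit r u i = radix_digit r v i.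
    case: i => // i /=; rewrite ltnS => ilt; apply/eqP; apply: contraTT ilt.
    by move=> /nmin; rewrite -leqNgt.
  have sep : 2^-1 * \prod_(1 <= i < n.+2) ((W i + r i)%:R ^- 2) <= `|G u - G v|.
    apply: (cf_expansion_separated R (fun i => W i + r i)%N (a u) (a v) n) => //.
    - by move=> i i0; split; exact: a1.
    - by move=> i i0; split; [case/andP: (aA u i u01 i0)|case/andP: (aA v i v01 i0)].
    - by move=> i i0 ilt; rewrite /a agree// i0.
    - by rewrite /a eqn_add2l.
  have := dist u v n u01 v01 agree.
  rewrite prodfV prodrXl in sep; set P := \prod_(1 <= i < n.+2) _ in sep *.
  have P0 : 0 < P := PA0 n.+2.
  set D : R := `|G u - G v| in sep *.
  have D0 : 0 < D by apply: lt_le_trans sep; rewrite mulr_gt0 ?invr_gt0 ?exprn_gt0.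
  have D1 : D <= 1.
    have /andP[x0 x1] := Gitv u; have /andP[y0 y1] := Gitv v.
    by rewrite /D ler_norml; apply/andP; split; lra.
  have PD : 1 <= (P ^+ 2 * (2 * D)) `^ t.
    rewrite -[leLHS](_ : 1 `^ t = 1 :> R); last by rewrite powR1.
    apply: ge0_ler_powR; rewrite ?nnegrE//; first exact: ltW.
      by rewrite mulr_ge0 ?exprn_ge0// ?mulr_ge0// ltW.
    by rewrite mulrA -ler_pdivrMl ?mulr_gt0 ?exprn_gt0// mulr1 mulrC invfM.
  rewrite powRrM (powR_mulrn 2 (ltW P0)) => uvP.
  apply: (@le_trans _ _ (C * 2 `^ t * D `^ t)); last first.
    apply: ler_wpM2l; first by rewrite mulr_ge0 ?powR_ge0// ltW.
    by apply: ger_powR => //; rewrite D0.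
  have P20 : 0 <= P ^+ 2 by rewrite exprn_ge0// ltW.
  have D20 : 0 <= 2 * D by rewrite mulr_ge0// ltW.
  rewrite (powRM t P20 D20) in PD.
  apply: (le_trans (ler_peMr (normr_ge0 (u - v)) PD)).
  rewrite mulrA [(2 * D) `^ t]powRM//; last exact: ltW.
  by rewrite -[leRHS]mulrA; apply: ler_wpM2r => //; rewrite mulr_ge0 ?powR_ge0.
(* All digits agree. As P is at least 2^n, the bound |u - v| P^(2t) <= C for every n rules out
   distinct points. *)
have [uv|uv] := eqVneq u v.
  by rewrite uv subrr normr0 !mulr_ge0 ?powR_ge0// ltW.
have d0 : 0 < `|u - v| by rewrite normr_gt0 subr_eq0.
have agree i : (0 < i)%N -> radix_digit r u i = radix_digit r v i.
  case: i => // i _; apply/eqP; apply: contra_notT same => neq; by exists i.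
have y0 : 0 < 2 * t by rewrite mulr_gt0.
have [n nC] := powR_unbounded (2 * t) (C / `|u - v|) y0.
have pow : 2 ^+ n <= \prod_(1 <= i < n.+2) (W i + r i)%:R :> R.
  apply: (@le_trans _ _ (2 ^+ n.+1)); first by rewrite ler_eXn2l ?ltr1n.
  have -> : 2 ^+ n.+1 = \prod_(1 <= i < n.+2) 2 :> R by rewrite prodr_const_nat subn1.
  apply: ler_prod => i _.
  rewrite ler0n/= ler_nat; case: (Wr i) => Wi _.
  exact: leq_trans Wi (leq_addr _ _).
have := dist u v n u01 v01 (fun i i0 => agree i (proj1 (andP i0))).
rewrite mulrC -ler_pdivlMr// leNgt => /negP []; apply: (lt_le_trans nC).
apply: ge0_ler_powR; rewrite ?nnegrE//; first exact: ltW.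
exact: ltW.
Qed.

Theorem theorem1p8 (R : realType) (alpha : R) (halpha : 2^-1 <= alpha) :
  hausdorff_dim (E_set (fun n : nat => expR (n%:R `^ alpha))) = (2^-1)%:E.
Proof.
apply/eqP; rewrite eq_le; apply/andP; split.
  apply/lee_addgt0Pr => e e0; apply: ereal_inf_lbound.
  exists (2^-1 + e); last by rewrite EFinD.
  split; first by rewrite addr_ge0// ltW.
  apply: hausdorff_measure_large_prod; first by rewrite ltrDl.
  move=> x [_ _ [a [ax Sa]]]; exists a; split => // M n0.
  by apply: E_set_large_prod halpha _ Sa; case: ax.
apply: le_ereal_inf_tmp => _ [s [s0 Hs] <-].
rewrite lee_fin leNgt; apply/negP => s2.
have := hausdorff_measure_E_set_neq0 alpha s halpha.
by rewrite s0 s2 Hs eqxx => /(_ isT).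
Qed.
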